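(* Let $K$ be an infinite field, $n\ge2$, $m\ge1$, and let $\ell_1,\dots,\ell_n$ be positive integers. Let $\Gamma=\bigcap_{k=1}^n(x_1^{\ell_1},\dots,\widehat{x_k^{\ell_k}},\dots,x_n^{\ell_n})^m\subset K[x_1,\dots,x_n]$ and let $\mathbb Y\subset\mathbb P^n_K$ be an $m$-fat complete grid of lines of type $(\ell_1,\dots,\ell_n)$. For every $h\in\{0,\dots,n-2\}$, the $h$-th total Betti number of the ideal $\Gamma$ and the $h$-th total Betti number of $\mathbb Y$ coincide with the $h$-th total Betti number of $n$ general $m$-fat points in $\mathbb P^{n-1}_K$. If $\mathbb Y$ is an $m$-fat complete grid of type $(1,\dots,1)$, then also the graded Betti numbers of $\mathbb Y$ coincide with those of $n$ general $m$-fat points in $\mathbb P^{n-1}_K$.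
   Context: $\widehat{\ }$ denotes omission. Complete grid: let $A_j=\{a_{j1},\dots,a_{j\ell_j}\}\subset K$ have $\ell_j$ elements ($1\le j\le n$) and let $X\subset\mathbb P^n_K$ be the set of the $\ell_1\cdots\ell_n$ points with coordinates in $\{1\}\times A_1\times\cdots\times A_n$ (coordinates counted from $0$ to $n$). Let $p_{\infty,k}$ be the point whose only nonzero coordinate is the $k$-th one. The complete grid of lines of type $(\ell_1,\dots,\ell_n)$ with basis $X$ is the set of the $\sum_i\ell_1\cdots\widehat{\ell_i}\cdots\ell_n$ lines joining $p$ and $p_{\infty,k}$, for $p\in X$, $1\le k\le n$. If $\mathcal P_1,\dots,\mathcal P_N\subset K[x_0,\dots,x_n]$ are the prime ideals of these lines, the $m$-fat complete grid is the scheme defined by $\mathcal P_1^m\cap\cdots\cap\mathcal P_N^m$. $n$ general $m$-fat points in $\mathbb P^{n-1}_K$: the scheme with saturated ideal $\bigcap_{i=1}^nI(p_i)^m$, where $p_1,\dots,p_n\in\mathbb P^{n-1}_K$ are not contained in any linear subvariety of dimension lower than $n-1$. The minimal graded free resolution of a homogeneous ideal $I$ is indexed as $\cdots\to F_1\to F_0\to I\to0$ with $F_h=\bigoplus_jR^{\beta_{h,j}}(-j)$ ($R$ the ambient polynomial ring); $\beta_{h,j}$ are the graded and $\beta_h=\sum_j\beta_{h,j}$ the total Betti numbers. Betti numbers of a closed projective scheme are those of its saturated ideal. *)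

(* Defs.v *)
From HB Require Import structures.
From mathcomp Require Import all_boot all_order all_algebra.
From mathcomp Require Import mpoly.

Set Implicit Arguments.
Unset Strict Implicit.
Unset Printing Implicit Defensive.

Import GRing.Theory.
Local Open Scope ring_scope.

Definition infinite_type (T : eqType) : Prop :=
  forall s : seq T, exists x : T, x \notin s.

(* Ideals of polynomial rings are handled as Prop-valued predicates, since    *)
(* membership in an intersection or saturation is not given as a boolean.     *)
Section Ideals.
Variables (K : fieldType) (n : nat).
Local Notation R := {mpoly K[n]}.

Definition ideal_gen (S : R -> Prop) (f : R) : Prop :=
  exists (r : nat) (c g : 'I_r -> R),
    (forall i, S (g i)) /\ f = \sum_(i < r) c i * g i.

Definition ideal_pow (I : R -> Prop) (m : nat) : R -> Prop :=
  ideal_gen (fun f => exists2 g : 'I_m -> R,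
                        forall i, I (g i) & f = \prod_(i < m) g i).

Definition irrelevant_ideal : R -> Prop :=
  ideal_gen (fun f => exists i : 'I_n, f = 'X_i).

Definition saturation (J : R -> Prop) (f : R) : Prop :=
  exists k : nat, forall g : R, ideal_pow irrelevant_ideal k g -> J (g * f).

(* A subspace U of K^n stands for the linear subvariety P(U) of P^(n-1); its  *)
(* projective dimension is \dim U - 1.  Keeping the zero vector of U here is  *)
(* harmless as soon as U is nonzero: homogeneous polynomials of positive      *)
(* degree vanish at it anyway.                                                *)
Definition vanishing_ideal (U : {vspace 'rV[K]_n}) : R -> Prop :=
  ideal_gen (fun f => (exists d : nat, f \is d.-homog) /\
                      forall v : 'rV[K]_n, v \in U -> f.@[v 0] = 0).

(* A complex ... -> F_1 -> F_0 -> R with F_h = \bigoplus_i R(- shift h i).    *)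
(* Elements of F_h are row vectors and the maps act by v |-> v *m _.          *)
Record free_complex := FreeComplex {
  rk : nat -> nat;
  shift : forall h : nat, 'I_(rk h) -> int;
  augm : 'M[R]_(rk 0, 1);
  bdry : forall h : nat, 'M[R]_(rk h.+1, rk h)
}.

(* f is zero or homogeneous of degree e - d, i.e., multiplication by f is a   *)
(* degree-preserving map R(-e) -> R(-d).                                      *)
Definition graded_entry (e d : int) (f : R) : Prop :=
  forall u : 'X_{1..n}, u \in msupp f -> (mdeg u)%:Z + d = e.

Definition graded_complex (F : free_complex) : Prop :=
  (forall i j, graded_entry (shift i) 0 (augm F i j)) /\
  (forall h i j, graded_entry (shift i) (shift j) (bdry F h i j)).

Definition resolves (I : R -> Prop) (F : free_complex) : Prop :=
  [/\ forall f : R, I f <-> exists v : 'rV[R]_(rk F 0), f%:M = v *m augm F,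
      forall v : 'rV[R]_(rk F 0),
        v *m augm F = 0 <-> exists w : 'rV[R]_(rk F 1), v = w *m bdry F 0
    & forall (h : nat) (v : 'rV[R]_(rk F h.+1)),
        v *m bdry F h = 0 <->
        exists w : 'rV[R]_(rk F h.+2), v = w *m bdry F h.+1].

Definition minimal_complex (F : free_complex) : Prop :=
  forall h i j, irrelevant_ideal (bdry F h i j).

Definition minimal_graded_free_resolution (I : R -> Prop) (F : free_complex) :
    Prop :=
  [/\ graded_complex F, resolves I F & minimal_complex F].

(* The Betti numbers are given as relations that include existence of a       *)
(* minimal graded free resolution and independence of its choice.             *)
Definition is_total_betti (I : R -> Prop) (h b : nat) : Prop :=
  (exists F, minimal_graded_free_resolution I F) /\
  (forall F, minimal_graded_free_resolution I F -> rk F h = b).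

Definition is_graded_betti (I : R -> Prop) (h : nat) (j : int) (b : nat) :
    Prop :=
  (exists F, minimal_graded_free_resolution I F) /\
  (forall F, minimal_graded_free_resolution I F ->
     #|[set i : 'I_(rk F h) | shift i == j]| = b).

(* The variables x_1, ..., x_n are 'X_i for i : 'I_n. *)
Definition Gamma (l : 'I_n -> nat) (m : nat) (f : R) : Prop :=
  forall k : 'I_n,
    ideal_pow
      (ideal_gen (fun g => exists2 i : 'I_n, i != k & g = 'X_i ^+ l i)) m f.

Definition general_points (p : 'I_n -> 'rV[K]_n) : Prop :=
  (forall i, p i != 0) /\
  ~ (exists2 U : {vspace 'rV[K]_n}, (\dim U < n)%N & forall i, p i \in U).

Definition fat_points_ideal (p : 'I_n -> 'rV[K]_n) (m : nat) (f : R) : Prop :=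
  forall i : 'I_n, ideal_pow (vanishing_ideal <[p i]>%VS) m f.

End Ideals.

(* In P^n the coordinate 0 is ord0 and the coordinate k (1 <= k <= n) is      *)
(* lift ord0 k' where k' = k - 1 : 'I_n.                                      *)
Section Grid.
Variables (K : fieldType) (n : nat).

Definition grid_sets (l : 'I_n -> nat) (A : 'I_n -> seq K) : Prop :=
  forall j : 'I_n, uniq (A j) /\ size (A j) = l j.

Definition grid_basis (A : 'I_n -> seq K) (p : 'rV[K]_n.+1) : Prop :=
  p 0 ord0 = 1 /\ forall j : 'I_n, p 0 (lift ord0 j) \in A j.

Definition p_infty (k : 'I_n) : 'rV[K]_n.+1 := delta_mx 0 (lift ord0 k).

Definition grid_line (A : 'I_n -> seq K) (L : {vspace 'rV[K]_n.+1}) : Prop :=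
  exists (p : 'rV[K]_n.+1) (k : 'I_n),
    grid_basis A p /\ L = (<[p]> + <[p_infty k]>)%VS.

Definition fat_grid_ideal (A : 'I_n -> seq K) (m : nat)
    (f : {mpoly K[n.+1]}) : Prop :=
  forall L, grid_line A L -> ideal_pow (vanishing_ideal L) m f.

Definition fat_grid_saturated_ideal (A : 'I_n -> seq K) (m : nat) :
    {mpoly K[n.+1]} -> Prop :=
  saturation (fat_grid_ideal A m).

End Grid.

(* Main.v *)
Require Import Defs.
From HB Require Import structures.
From mathcomp Require Import all_boot all_order all_algebra.
From mathcomp Require Import mpoly ssrcomplements.
From mathcomp Require Import zify.
From Stdlib Require Import Classical ClassicalEpsilon.

Set Implicit Arguments.
Unset Strict Implicit.
Unset Printing Implicit Defensive.

Import GRing.Theory.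
Local Open Scope ring_scope.

(** The three ideals are extensions of one and the same monomial ideal.

    Let J be the ideal of the m-fat coordinate points of P^(n-1), that is, the
    intersection over k of the ideals (x_s : s <> k)^m. It is spanned by the
    monomials x^u such that the sum of the u_s with s <> k is at least m for
    every k. Then
    - Gamma is the extension of J under x_s := x_s^(l_s);
    - the ideal of the fat grid is the extension of J under x_s := f_s, where
      f_s is the product of the linear forms x_s - a x_0 for a in A_s;
    - the ideal of n general fat points is the image of J under a linear change
      of coordinates.
    In each case the target ring is free over the image of the substitution, so
    the substitution turns a minimal free resolution of J into a minimal free
    resolution of the extension, with the same ranks. A generator of
    multidegree u becomes a generator of degree the sum of the l_s u_s, hence
    the graded Betti numbers agree as well when all l_s are 1.

    Since the substitutions give different degrees to the variables, J needs a
    minimal resolution that is graded by exponent vectors. Its stages are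
    scalar matrices with a multidegree for each row ([mresolution]). Syzygies
    of generators whose degrees divide a monomial B are generated in degrees
    that divide B, because the relations of degree u depend only on the set of
    generators whose degree divides x^u; so finiteness comes for free, and
    minimality is obtained by discarding redundant generators.

    The freeness of the target ring is used in the form of a linear bijection
    Theta of the target ring to itself that converts multiplication by
    x_s^(l_s) into multiplication by f_s ([base_change]). For the grid, Theta
    sends the monomials to products of Newton interpolation polynomials whose
    nodes run periodically through the sets A_s. In this basis the powers of
    the ideals of the lines of a given direction k intersect in the span of the
    basis elements w such that the sum of the w_s %/ l_s with s <> k is at
    least m ([newton_key]), and this gives at once the description of the ideal
    of the grid ([grid_star]) and the injectivity of Theta.

    That Betti numbers do not depend on the resolution is the usual comparison
    of two minimal resolutions by chain maps that are inverse up to homotopy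
    ([comparison_consts]). *)

(** * Supports and coefficients *)

Section Support.
Variables (R : nzRingType) (n : nat).
Implicit Types (f g : {mpoly R[n]}) (u v : 'X_{1..n}).

Lemma mcoeff_sumX (s : seq 'X_{1..n}) (c : 'X_{1..n} -> R) u :
  uniq s -> (\sum_(w <- s) c w *: 'X_[w])@_u = if u \in s then c u else 0.
Proof.
move=> us; rewrite raddf_sum /=; case: ifP => hu.
  rewrite (bigD1_seq u) //= mcoeffZ mcoeffX eqxx mulr1 big1 ?addr0 //.
  by move=> w /negPf nw; rewrite mcoeffZ mcoeffX nw mulr0.
rewrite big_seq big1 // => w hw; rewrite mcoeffZ mcoeffX.
by case: eqP => [e|_]; [rewrite -e hw in hu|rewrite mulr0].
Qed.

Definition mfilter (P : pred 'X_{1..n}) f :=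
  \sum_(w <- [seq w <- msupp f | P w]) f@_w *: 'X_[w].

Lemma mcoeff_mfilter P f u : (mfilter P f)@_u = if P u then f@_u else 0.
Proof.
rewrite mcoeff_sumX ?filter_uniq ?msupp_uniq // mem_filter.
by case: (P u) => //=; case: ifPn => // /memN_msupp_eq0 ->.
Qed.

Lemma msuppM_ex f g w : w \in msupp (f * g) ->
  exists u v, [/\ u \in msupp f, v \in msupp g & w = (u + v)%MM].
Proof. by case/msuppM_le/allpairsP=> -[u v] [/= hu hv ->]; exists u, v. Qed.

Lemma mcoeffMXl f u v :
  ('X_[u] * f)@_v = if (u <= v)%MM then f@_(v - u) else 0.
Proof.
rewrite -commr_mpolyX; case: ifPn => [h|].
  by rewrite -[in LHS](submK h) addmC mcoeffMX.
apply: contraNeq; rewrite -mcoeff_msupp => /msuppM_ex [a] [b] [_].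
by rewrite msuppX inE => /eqP -> ->; apply: lem_addl.
Qed.

End Support.

(** * Independence of Betti numbers from the resolution *)

Section Uniqueness.
Variables (K : fieldType) (n : nat).
Local Notation R := {mpoly K[n]}.
Implicit Types (I : R -> Prop) (F G : free_complex K n).

Lemma irrelevant_coef0 (f : R) : irrelevant_ideal f -> f@_0%MM = 0.
Proof.
case=> r [c [g [hg ->]]]; rewrite raddf_sum big1 // => i _ /=.
by case: (hg i) => k ->; rewrite rmorphM /= mcoeffX mnm1_eq0 mulr0.
Qed.

Definition homog_part (e : int) : R -> R := mfilter (fun u => (mdeg u)%:Z == e).

Lemma graded_entry_homog_part (e d : int) (f : R) :
  graded_entry e d (homog_part (e - d) f).
Proof.
move=> u; rewrite mcoeff_msupp mcoeff_mfilter.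
by case: ifP => [/eqP ->|_]; rewrite ?subrK // eqxx.
Qed.

Lemma homog_part_id (e d : int) (f : R) :
  graded_entry e d f -> homog_part (e - d) f = f.
Proof.
move=> h; apply/mpolyP => u; rewrite mcoeff_mfilter.
case: eqP => // ne; apply/esym/eqP; apply: contra_notT ne.
by rewrite -mcoeff_msupp => /h <-; rewrite addrK.
Qed.

(** Multiplication by a graded entry shifts degrees, so it commutes with taking
    homogeneous parts. This is what makes lifts through graded matrices graded.
    *)
Lemma homog_partM (e d b : int) (f g : R) :
  graded_entry d b g -> homog_part (e - b) (f * g) = homog_part (e - d) f * g.
Proof.
move=> hg; apply/mpolyP => u; rewrite mcoeff_mfilter !mcoeffM.
transitivity (\sum_(k : 'X_{1..n < (mdeg u).+1, (mdeg u).+1} | u ==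
  (k.1 + k.2)%MM)
   (if (mdeg u)%:Z == e - b then f@_k.1 * g@_k.2 else 0)).
  by case: ifP => _ //; rewrite big1.
apply: eq_bigr => -[k1 k2] /= /eqP eu; rewrite mcoeff_mfilter.
have [->|nz] := eqVneq (g@_k2) 0; first by rewrite !mulr0 if_same.
have /hg hd : (k2 : 'X_{1..n}) \in msupp g by rewrite mcoeff_msupp.
have -> : ((mdeg u)%:Z == e - b) = ((mdeg k1)%:Z == e - d).
  have := congr1 (@mdeg n) eu; rewrite mdegD -hd => em; apply/eqP/eqP; lia.
by case: ifP; rewrite ?mul0r.
Qed.

Lemma homog_part_sum e k (f : 'I_k -> R) :
  homog_part e (\sum_i f i) = \sum_i homog_part e (f i).
Proof.
apply/mpolyP => u; rewrite mcoeff_mfilter !(raddf_sum (mcoeff u)).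
transitivity (\sum_i if (mdeg u)%:Z == e then (f i)@_u else 0).
  by case: ifP => // _; rewrite big1.
by apply: eq_bigr => i _; apply/esym; apply: mcoeff_mfilter.
Qed.

Definition graded_matrix r s (a : 'I_r -> int) (b : 'I_s -> int)
    (M : 'M[R]_(r, s)) :=
  forall i j, graded_entry (a i) (b j) (M i j).

(** An arbitrary lift of the rows can be replaced by its part of the right
    degree in each entry, because the equation to be solved is itself
    homogeneous. *)
Lemma graded_lift r s t (a : 'I_r -> int) (b : 'I_s -> int) (c : 'I_t -> int)
    (N : 'M[R]_(t, s)) (M : 'M[R]_(r, s)) :
  graded_matrix c b N -> graded_matrix a b M ->
  (forall i, exists w : 'rV[R]_t, row i M = w *m N) ->
  exists2 Q : 'M[R]_(r, t), graded_matrix a c Q & M = Q *m N.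
Proof.
move=> hN hM /fin_all_exists [w hw].
exists (\matrix_(i, k) homog_part (a i - c k) (w i 0 k)).
  by move=> i k; rewrite mxE; apply: graded_entry_homog_part.
apply/matrixP => i j; rewrite -(homog_part_id (hM i j)).
have -> : M i j = \sum_k w i 0 k * N k j.
  by move/matrixP: (hw i) => /(_ 0 j); rewrite !mxE.
rewrite homog_part_sum mxE; apply: eq_bigr => k _.
by rewrite mxE (homog_partM _ _ (hN k j)).
Qed.

(** The kernel of the map out of F_h, the augmentation being the map out of
    F_0: with this convention the two stages treated separately by [resolves]
    become one. *)
Definition cycles F h : 'rV[R]_(rk F h) -> Prop :=
  match h with
  | 0 => fun v => v *m augm F = 0
  | h'.+1 => fun v => v *m bdry F h' = 0
  end.

Lemma cyclesP I F h (v : 'rV_(rk F h)) : resolves I F ->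
  cycles v <-> exists w, v = w *m bdry F h.
Proof. by case=> _ h0 h1; case: h v => [|h] v /=; [apply: h0|apply: h1]. Qed.

Lemma cyclesM I F h (w : 'rV_(rk F h.+1)) : resolves I F ->
  cycles (w *m bdry F h).
Proof. by move=> hF; apply/(cyclesP _ hF); exists w. Qed.

Lemma mulmx_rows (S : pzRingType) (r s : nat) (M : 'M[S]_(r, s)) :
  (forall v : 'rV_r, v *m M = 0) -> M = 0.
Proof. by move=> h; apply/row_matrixP => i; rewrite rowE h row0. Qed.

(** The state of the usual comparison argument in homological degree h: [p] and
    [q] are the degree h components of chain maps F -> G -> F, and [t] is d
    followed by the previous component of a homotopy from the identity to the
    composite. Keeping only the properties of these three matrices lets the
    induction forget all earlier components. The field [cmp_0] says that [t]
    vanishes modulo the irrelevant ideal, which is where minimality of F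
    enters. *)
Record compared F G h (p : 'M[R]_(rk F h, rk G h))
    (q : 'M[R]_(rk G h, rk F h)) (t : 'M[R]_(rk F h)) : Prop := Compared {
  cmp_gp : graded_matrix (@shift _ _ F h) (@shift _ _ G h) p;
  cmp_gq : graded_matrix (@shift _ _ G h) (@shift _ _ F h) q;
  cmp_p : forall v, cycles v -> cycles (v *m p);
  cmp_q : forall v, cycles v -> cycles (v *m q);
  cmp_t : forall v, cycles v -> v *m t = 0;
  cmp_0 : forall i j, (t i j)@_0%MM = 0;
  cmp_h : forall v, cycles (v *m (p *m q - 1%:M - t)) }.

Lemma compare0 I F G :
  minimal_graded_free_resolution I F -> minimal_graded_free_resolution I G ->
  exists p q t, @compared F G 0 p q t.
Proof.
move=> [[gF _] rF _] [[gG _] rG _].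
have lift F' G' : (forall i j, graded_entry (shift i) 0 (augm F' i j)) ->
    (forall i j, graded_entry (shift i) 0 (augm G' i j)) ->
    resolves I F' -> resolves I G' ->
    exists2 Q : 'M[R]_(rk F' 0, rk G' 0),
      graded_matrix (@shift _ _ F' 0) (@shift _ _ G' 0) Q & augm F' =
        Q *m augm G'.
  move=> gF' gG' [iF _ _] [iG _ _].
  apply: (@graded_lift _ _ _ _ (fun=> 0)) => // i; rewrite rowE.
  suff e : (augm F' i 0)%:M = delta_mx 0 i *m augm F'.
    by rewrite -e; apply/iG/iF; exists (delta_mx 0 i).
  by rewrite -rowE; apply/matrixP => a b; rewrite !ord1 !mxE.
have [p gp ep] := lift F G gF gG rF rG.
have [q gq eq] := lift G F gG gF rG rF.
exists p, q, 0; split=> //=.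
- by move=> v; rewrite ep mulmxA.
- by move=> v; rewrite eq mulmxA.
- by move=> v _; rewrite mulmx0.
- by move=> i j; rewrite mxE mcoeff0.
by move=> v; rewrite subr0 -mulmxA mulmxBl mul1mx -mulmxA -eq -ep subrr mulmx0.
Qed.

(** Exactness of G lifts [p] and exactness of F lifts [q] and yields the next
    component [s] of the homotopy; the new [t] is d followed by [s]. *)
Lemma compareS I F G h p q t :
  minimal_graded_free_resolution I F -> minimal_graded_free_resolution I G ->
  @compared F G h p q t -> exists p' q' t', @compared F G h.+1 p' q' t'.
Proof.
move=> [[_ gF] rF mF] [[_ gG] rG mG] [gp gq hp hq ht h0 hh].
have gmM r s k (a : 'I_r -> int) (b : 'I_s -> int) (c : 'I_k -> int) M N :
    graded_matrix a b M -> graded_matrix b c N -> graded_matrix a c (M *m N).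
  move=> gM gN i j u; rewrite mxE mcoeff_msupp raddf_sum /= => nz.
  have [l _ nl] : exists2 l, true & (M i l * N l j)@_u != 0.
    apply/exists_inP; apply: contraNT nz => /exists_inPn hl.
    by rewrite big1 // => l _; apply/eqP; rewrite -[_ == _]negbK; apply: hl.
  rewrite -mcoeff_msupp in nl; have [x [y [/gM ex /gN ey ->]]] := msuppM_ex nl.
  rewrite mdegD; lia.
have [p' gp' ep] : exists2 p', graded_matrix (@shift _ _ F h.+1)
  (@shift _ _ G h.+1) p'
    & bdry F h *m p = p' *m bdry G h.
  apply: graded_lift (gG h) (gmM _ _ _ _ _ _ _ _ (gF h) gp) _ => i.
  apply/(cyclesP _ rG); rewrite rowE mulmxA; apply: hp; exact: cyclesM rF.
have [q' gq' eq] : exists2 q', graded_matrix (@shift _ _ G h.+1)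
  (@shift _ _ F h.+1) q'
    & bdry G h *m q = q' *m bdry F h.
  apply: graded_lift (gF h) (gmM _ _ _ _ _ _ _ _ (gG h) gq) _ => i.
  apply/(cyclesP _ rF); rewrite rowE mulmxA; apply: hq; exact: cyclesM rG.
have [s es] : exists s, p *m q - 1%:M - t = s *m bdry F h.
  have /fin_all_exists [w hw] i : exists w : 'rV_(rk F h.+1),
      row i (p *m q - 1%:M - t) = w *m bdry F h.
    by apply/(cyclesP _ rF); rewrite rowE.
  exists (\matrix_i w i); apply/row_matrixP => i.
  by rewrite hw row_mul rowK.
have bt : bdry F h *m t = 0.
  by apply: mulmx_rows => v; rewrite mulmxA; apply/ht; apply: cyclesM rF.
exists p', q', (bdry F h *m s); split=> //=.
- by move=> v hv; rewrite -mulmxA -ep mulmxA hv mul0mx.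
- by move=> v hv; rewrite -mulmxA -eq mulmxA hv mul0mx.
- by move=> v hv; rewrite mulmxA hv mul0mx.
- move=> i j; rewrite mxE raddf_sum big1 // => k _ /=.
  by rewrite rmorphM /= (irrelevant_coef0 (mF _ _ _)) mul0r.
move=> v; rewrite -mulmxA; apply/eqP; rewrite -[X in _ == X](mulmx0 _ v);
  apply/eqP.
congr (_ *m _); rewrite !mulmxBl mul1mx -!mulmxA -es -eq [p' *m _]mulmxA -ep.
by rewrite !mulmxBr bt mulmx1 subr0 -!mulmxA subrr.
Qed.

Lemma comparison I F G h :
  minimal_graded_free_resolution I F -> minimal_graded_free_resolution I G ->
  exists p q t, @compared F G h p q t.
Proof.
move=> hF hG; elim: h => [|h [p [q [t ih]]]]; first exact: compare0 hF hG.
exact: compareS hF hG ih.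
Qed.

(** Modulo the irrelevant ideal both parts of the homotopy vanish, so the
    composite of the chain maps becomes the identity. A graded entry with a
    nonzero constant term joins generators of the same degree. *)
Lemma comparison_consts I F G h :
  minimal_graded_free_resolution I F -> minimal_graded_free_resolution I G ->
  exists (P : 'M[K]_(rk F h, rk G h)) (Q : 'M[K]_(rk G h, rk F h)),
    P *m Q = 1%:M /\ (forall i j, P i j != 0 -> shift i = shift j).
Proof.
move=> hF hG; have [p [q [t [gp _ _ _ _ t0 hh]]]] := comparison h hF hG.
case: hF => _ rF mF; pose c := mcoeff 0%MM : R -> K.
exists (map_mx c p), (map_mx c q); split; last first.
  move=> i j; rewrite mxE /c -mcoeff_msupp => /gp.
  by rewrite mdeg0 add0r.
rewrite -map_mxM /=; apply/matrixP => i j.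
have [w ew] : exists w : 'rV_(rk F h.+1), delta_mx 0 i *m (p *m q - 1%:M - t) =
  w *m bdry F h.
  by apply/(cyclesP _ rF).
have : c ((p *m q - 1%:M - t) i j) = 0.
  move: ew => /matrixP /(_ 0 j); rewrite -rowE [LHS]mxE => ->.
  rewrite mxE /c raddf_sum big1 // => k _ /=.
  by rewrite rmorphM /= (irrelevant_coef0 (mF _ _ _)) mulr0.
move: (p *m q) => A; rewrite !mxE /c !raddfB /= t0 subr0 => /eqP.
rewrite subr_eq0 => /eqP ->; by case: (i == j); rewrite ?mcoeff1 ?eqxx ?mcoeff0.
Qed.

(** The constant matrices are block diagonal for the degrees, so the block of
    degree j already has a right inverse. *)
Lemma graded_rank_le I F G h (j : int) :
  minimal_graded_free_resolution I F -> minimal_graded_free_resolution I G ->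
  (#|[set i : 'I_(rk F h) | shift i == j]| <=
   #|[set i : 'I_(rk G h) | shift i == j]|)%N.
Proof.
move=> hF hG; have [P [Q [PQ gP]]] := comparison_consts h hF hG.
set A := [set i | _]; set B := [set i | _].
pose P' : 'M[K]_(#|A|, #|B|) := \matrix_(x, y) P (enum_val x) (enum_val y).
pose Q' : 'M[K]_(#|B|, #|A|) := \matrix_(x, y) Q (enum_val x) (enum_val y).
suff : P' *m Q' = 1%:M by apply: mulmx1_min.
apply/matrixP => x y; rewrite !mxE.
transitivity (\sum_(k in B) P (enum_val x) k * Q k (enum_val y)).
  rewrite (big_enum_val (fun k => P (enum_val x) k * Q k (enum_val y))) /=.
  by apply: eq_bigr => k _; rewrite !mxE.
move/matrixP: PQ => /(_ (enum_val x) (enum_val y));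
  rewrite !mxE (inj_eq enum_val_inj) => <-.
rewrite [RHS](bigID (mem B)) /= [X in _ = _ + X]big1 ?addr0 // => k hk.
have [->|/gP e] := eqVneq (P (enum_val x) k) 0; first by rewrite mul0r.
by have := enum_valP x; rewrite inE e => hx; rewrite inE hx in hk.
Qed.

Lemma rank_le I F G h :
  minimal_graded_free_resolution I F -> minimal_graded_free_resolution I G ->
  (rk F h <= rk G h)%N.
Proof.
move=> hF hG; have [P [Q [PQ _]]] := comparison_consts h hF hG.
exact: mulmx1_min PQ.
Qed.

Lemma total_betti_of I F h :
  minimal_graded_free_resolution I F -> is_total_betti I h (rk F h).
Proof.
move=> hF; split; first by exists F.
by move=> G hG; apply/eqP; rewrite eqn_leq (rank_le _ hG hF) (rank_le _ hF hG).
Qed.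

Lemma graded_betti_of I F h (j : int) : minimal_graded_free_resolution I F ->
  is_graded_betti I h j #|[set i : 'I_(rk F h) | shift i == j]|.
Proof.
move=> hF; split; first by exists F.
move=> G hG; apply/eqP; rewrite eqn_leq.
by rewrite (graded_rank_le _ _ hG hF) (graded_rank_le _ _ hF hG).
Qed.

End Uniqueness.

(** * Multigraded minimal resolutions *)

Section Multigraded.
Variables (K : fieldType) (n : nat).
Local Notation mon := 'X_{1..n}.

(** A multigraded free module over K[x_1, ..., x_n] with generators of degrees
    a_i has, in degree u, a basis formed by the generators with a_i <= u. Its
    elements of degree u are thus row vectors of scalars that are [below a u],
    and multigraded maps are scalar matrices: the monomials are determined by
    the degrees. *)
Definition below r (a : 'I_r -> mon) (u : mon) (c : 'rV[K]_r) :=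
  forall i, c 0 i != 0 -> (a i <= u)%MM.

Definition generates r s (V : mon -> 'rV[K]_s -> Prop) (a : 'I_r -> mon)
    (C : 'M[K]_(r, s)) :=
  forall u c, V u c <-> exists2 d, below a u d & c = d *m C.

Definition relation r s (a : 'I_r -> mon) (C : 'M[K]_(r, s)) u (c : 'rV[K]_r) :=
  below a u c /\ c *m C = 0.

(** No relation of degree u has a nonzero scalar at a generator of degree u:
    equivalently, no generator is a combination of the others. *)
Definition irredundant r s (a : 'I_r -> mon) (C : 'M[K]_(r, s)) :=
  forall u c, relation a C u c -> forall i, a i = u -> c 0 i = 0.

Lemma below_delta r (a : 'I_r -> mon) i : below a (a i) (delta_mx 0 i).
Proof.
by move=> j; rewrite mxE eqxx /=; have [->|_] := eqVneq j i;
  rewrite ?lepm_refl // eqxx.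
Qed.

Lemma generates_row r s V (a : 'I_r -> mon) (C : 'M[K]_(r, s)) i :
  generates V a C -> V (a i) (row i C).
Proof.
by move=> gV; apply/gV; exists (delta_mx 0 i);
  [apply: below_delta|rewrite rowE].
Qed.

(** A generator that occurs with a nonzero scalar in a relation of its own
    degree is a combination of generators of smaller or equal degree, so it can
    be dropped; the number of generators bounds how often this happens. *)
Lemma generates_irredundant r s V (a : 'I_r -> mon) (C : 'M[K]_(r, s)) :
  generates V a C ->
  exists r' (a' : 'I_r' -> mon) (C' : 'M[K]_(r', s)),
    generates V a' C' /\ irredundant a' C'.
Proof.
elim: r a C => [|r ih] a C gV; first by exists 0%N, a, C; split=> // u c _ [].
have [irr|red] := classic (irredundant a C); first by exists r.+1, a, C.
have [u [d [i [[bd d0] ai di]]]] : exists u d i,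
    [/\ relation a C u d, a i = u & d 0 i != 0].
  apply: NNPP => ne; apply: red => u c hc i ai; apply/eqP.
  by apply: contra_notT ne => ci; exists u, c, i.
apply: (ih (fun k => a (lift i k)) (row' i C)) => v c; split=> [/gV|].
  (* Subtract the multiple of the relation d that clears the coordinate i. *)
  move=> [e be ->]; pose e' := e - (e 0 i / d 0 i) *: d.
  have e'i : e' 0 i = 0 by rewrite !mxE divfK // subrr.
  exists (col' i e') => [k|].
    rewrite !mxE => nz; have [ek|/be //] := eqVneq (e 0 (lift i k)) 0.
    rewrite ek sub0r oppr_eq0 !mulf_eq0 !negb_or in nz.
    case/andP: nz => /andP[/be hi _] /bd hk.
    by apply: lepm_trans hi; rewrite ai.
  have -> : e *m C = e' *m C by rewrite mulmxBl -scalemxAl d0 scaler0 subr0.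
  apply/matrixP => x y; rewrite !mxE (bigD1_ord i) //= ord1 e'i mul0r add0r.
  by apply: eq_bigr => k _; rewrite !mxE.
move=> [e be ->]; apply/gV.
exists (\row_k if unlift i k is Some k' then e 0 k' else 0) => [k|].
  by rewrite mxE; case: unliftP => [k' ->|->]; [apply: be|rewrite eqxx].
apply/matrixP => x y; rewrite !mxE [RHS](bigD1_ord i) //= mxE unlift_none mul0r
  add0r.
by apply: eq_bigr => k _; rewrite !mxE liftK ord1.
Qed.

(** If every V u is already reached at some degree below the fixed monomial B,
    then bases of the finitely many spaces V w with w <= B generate everything.
    This replaces the Noetherian property. *)
Lemma bounded_generates s (V : mon -> 'M[K]_s) (B : mon) :
  (forall u v, (u <= v)%MM -> (V u <= V v)%MS) ->
  (forall u, exists w, [/\ (w <= u)%MM, (w <= B)%MM & (V u <= V w)%MS]) ->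
  exists r (a : 'I_r -> mon) (C : 'M[K]_(r, s)),
    generates (fun u c => (c <= V u)%MS) a C.
Proof.
move=> Vmono Vbnd; pose T := ('X_{1..n < (mdeg B).+1} * 'I_s)%type.
pose a (k : 'I_#|{: T}|) : mon := (enum_val k).1.
pose C := \matrix_(k < #|{: T}|) row (enum_val k).2 (V (a k)).
exists #|{: T}|, a, C => u c; split=> [hc|[d bd ->]]; last first.
  rewrite mulmx_sum_row summx_sub // => k _; rewrite rowK.
  have [->|/bd h] := eqVneq (d 0 k) 0; first by rewrite scale0r sub0mx.
  by rewrite scalemx_sub // (submx_trans (row_sub _ _)) ?Vmono.
have [w [wu wB Vw]] := Vbnd u.
have wlt : (mdeg w < (mdeg B).+1)%N.
  by rewrite ltnS !mdegE leq_sum // => i _; apply/mnm_lepP.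
have /submxP [d ed] := submx_trans hc Vw; pose w' := BMultinom wlt.
(* The rows that come from degree w already span V w. *)
exists (\row_k if (enum_val k).1 == w' then d 0 (enum_val k).2 else 0) => [k|].
  by rewrite mxE /a; case: ifP => [/eqP -> //|_]; rewrite eqxx.
rewrite mulmx_sum_row ed mulmx_sum_row.
transitivity (\sum_(k : T)
  (if k.1 == w' then d 0 k.2 else 0) *: row k.2 (V k.1)); last first.
  rewrite [LHS](big_enum_val (A := {: T})) /=; apply: eq_bigr => k _.
  by rewrite mxE rowK.
rewrite -(pair_bigA _ (fun k1 k2 =>
  (if k1 == w' then d 0 k2 else 0) *: row k2 (V k1))) /=.
rewrite (bigD1 w') //= [X in _ = _ + X]big1 ?addr0 => [|k1 /negPf nk];
  last first.
  by rewrite big1 // => k2 _; rewrite nk scale0r.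
by apply: eq_bigr => k2 _; rewrite eqxx.
Qed.

(** The diagonal block forces the coordinates at generators of degree not below
    u to vanish. *)
Definition relmx r s (a : 'I_r -> mon) (C : 'M[K]_(r, s)) u : 'M[K]_r :=
  kermx (row_mx C (diag_mx (\row_i (~~ (a i <= u)%MM)%:R))).

Lemma relmxP r s (a : 'I_r -> mon) (C : 'M[K]_(r, s)) u c :
  reflect (relation a C u c) (c <= relmx a C u)%MS.
Proof.
rewrite /relmx; apply: (iffP sub_kermxP).
  rewrite mul_mx_row -row_mx0 => /eq_row_mx [c0 /matrixP d0]; split=> // i ci.
  move: (d0 0 i); rewrite mul_mx_diag !mxE => /eqP;
    rewrite mulf_eq0 (negPf ci) /=.
  by case: (_ <= _)%MM; rewrite //= oner_eq0.
move=> [bc c0]; rewrite mul_mx_row c0 -row_mx0; congr row_mx.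
apply/matrixP => x y; rewrite mul_mx_diag !mxE ord1.
by have [->|/bc ->] := eqVneq (c 0 y) 0; rewrite ?mul0r ?mulr0.
Qed.

Definition mnm_min (u v : mon) : mon := [multinom minn (u i) (v i) | i < n].

(** The relations of degree u depend only on which generators have degree <= u,
    hence only on the minimum of u and the least common multiple B of the
    degrees of the generators. *)
Lemma syzygies r s (a : 'I_r -> mon) (C : 'M[K]_(r, s)) :
  exists r' (a' : 'I_r' -> mon) (C' : 'M[K]_(r', r)),
    generates (relation a C) a' C' /\ irredundant a' C'.
Proof.
pose B : mon := [multinom \max_(k < r) a k i | i < n].
have [||r' [a' [C' gV]]] := @bounded_generates r (relmx a C) B.
- move=> u v uv; apply/row_subP => i; apply/relmxP.
  have [b e] : relation a C u (row i (relmx a C u)) by apply/relmxP;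
    apply: row_sub.
  by split=> // k /b h; apply: lepm_trans uv.
- move=> u; exists (mnm_min u B); split; first 2 last.
  + apply/row_subP => i; apply/relmxP.
    have [b e] : relation a C u (row i (relmx a C u)) by apply/relmxP;
      apply: row_sub.
    split=> // k /b /mnm_lepP h; apply/mnm_lepP => x.
    by rewrite !mnmE leq_min h (leq_bigmax (F := fun k => a k x)).
  + by apply/mnm_lepP => x; rewrite mnmE geq_minl.
  + by apply/mnm_lepP => x; rewrite mnmE geq_minr.
apply: (generates_irredundant (C := C') (a := a')) => u c.
by rewrite -gV; split=> /relmxP.
Qed.

(** Only scalars are kept: the entry (i, j) of [mbdry M h] stands for that
    scalar times the monomial whose exponent is the difference of the degrees
    of row i and column j. *)
Record mcomplex := MComplex {
  mrk : nat -> nat;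
  mdegs : forall h, 'I_(mrk h) -> mon;
  maug : 'M[K]_(mrk 0, 1);
  mbdry : forall h, 'M[K]_(mrk h.+1, mrk h) }.

(** The degree u part of the monomial ideal with monomials J, as a subspace of
    the one-dimensional degree u part of the polynomial ring. *)
Definition monomial_ideal (J : mon -> Prop) (u : mon) (c : 'rV[K]_1) :=
  c = 0 \/ J u.

Record mresolves (J : mon -> Prop) (M : mcomplex) : Prop := MResolves {
  mres_aug : generates (monomial_ideal J) (@mdegs M 0) (maug M);
  mres_0 : generates (relation (@mdegs M 0) (maug M)) (@mdegs M 1) (mbdry M 0);
  mres_S : forall h, generates (relation (@mdegs M h.+1) (mbdry M h))
                               (@mdegs M h.+2) (mbdry M h.+1);
  mres_min0 : irredundant (@mdegs M 0) (maug M);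
  mres_minS : forall h, irredundant (@mdegs M h.+1) (mbdry M h) }.

(** Iterating [syzygies] resolves any monomial ideal whose generators are
    bounded by B. The row of a stage is a relation among the generators of the
    previous one, so irredundancy of each stage makes the complex minimal. *)
Lemma mresolution (J : mon -> Prop) (B : mon) :
  (forall u v, (u <= v)%MM -> J u -> J v) ->
  (forall u, J u -> J (mnm_min u B)) ->
  exists M, mresolves J M.
Proof.
move=> Jmono Jbnd.
pose stage := {r : nat & {s : nat & (('I_r -> mon) * 'M[K]_(r, s))%type}}.
have [b bP] : exists b : mon -> bool, forall u, b u <-> J u.
  exists (fun u => if excluded_middle_informative (J u) then true else false) =>
    u.
  by destruct (excluded_middle_informative (J u)).
pose V u : 'M[K]_1 := (b u)%:R%:M.
have VP u c : (c <= V u)%MS <-> monomial_ideal J u c.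
  rewrite /V /monomial_ideal -bP; case: (b u).
    by rewrite submx1; split=> // _; right.
  by rewrite raddf0 submx0; split=> [/eqP ->|[->|//]]; [left|apply: eqxx].
have Vsub u v : (J u -> J v) -> (V u <= V v)%MS.
  rewrite -!bP /V; move=> h; case: (b u) h => [-> //|_];
    by rewrite raddf0 sub0mx.
have [|u|r0 [a0 [C0 g0]]] := @bounded_generates 1 V B.
- by move=> u v uv; apply: Vsub; apply: Jmono uv.
- exists (mnm_min u B); split; last by apply: Vsub; apply: Jbnd.
  + by apply/mnm_lepP => x; rewrite mnmE geq_minl.
  + by apply/mnm_lepP => x; rewrite mnmE geq_minr.
have {}g0 : generates (monomial_ideal J) a0 C0 by move=> u c; rewrite -VP;
  apply: g0.
have {g0} [r [a [C [g m]]]] := generates_irredundant g0.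
have [next nextP] : exists next : forall x : stage,
      {r : nat & ({a : 'I_r -> mon & 'M[K]_(r, tag x)})%type},
    forall x, generates (relation (tagged (tagged x)).1 (tagged (tagged x)).2)
      (tag (tagged (next x))) (tagged (tagged (next x))) /\
      irredundant (tag (tagged (next x))) (tagged (tagged (next x))).
  have h (x : stage) : exists y :
    {r : nat & ({a : 'I_r -> mon & 'M[K]_(r, tag x)})%type},
      generates (relation (tagged (tagged x)).1 (tagged (tagged x)).2)
        (tag (tagged y)) (tagged (tagged y)) /\
      irredundant (tag (tagged y)) (tagged (tagged y)).
    case: x => [r1 [s1 [a1 C1]]] /=; have [r2 [a2 [C2 h2]]] := syzygies a1 C1.
    by exists (existT _ r2 (existT _ a2 C2)).
  exists (fun x => sval (constructive_indefinite_description _ (h x))) => x.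
  exact: (svalP (constructive_indefinite_description _ (h x))).
pose st h : stage := iter h (fun x => let y := next x in
  existT _ (tag y) (existT _ (tag x) (tag (tagged y), tagged (tagged y))))
  (existT _ r (existT _ 1%N (a, C))).
exists (@MComplex (fun h => tag (st h)) (fun h => (tagged (tagged (st h))).1) C
  (fun h => tagged (tagged (next (st h))))).
split.
- exact: g.
- exact: (proj1 (nextP (st 0%N))).
- move=> h; exact: (proj1 (nextP (st h.+1))).
- exact: m.
- move=> h; exact: (proj2 (nextP (st h))).
Qed.

End Multigraded.

(** * Base change of a multigraded resolution *)

Lemma prod_homog (R : nzRingType) n N (F : 'I_n -> {mpoly R[N]})
  (d u : 'I_n -> nat) :
  (forall j, F j \is (d j).-homog) ->
  \prod_j F j ^+ u j \is (\sum_j d j * u j)%N.-homog.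
Proof.
move=> hF; elim: (index_enum 'I_n) => [|j r ih].
  by rewrite !big_nil dhomog1.
by rewrite !big_cons; apply: dhomogM ih; apply: dhomogMn.
Qed.

Section BaseChange.
Variables (K : fieldType) (n N : nat) (iota : 'I_n -> 'I_N) (l : 'I_n -> nat).
Hypothesis iotaI : injective iota.
Hypothesis l_gt0 : forall s, (0 < l s)%N.
Local Notation mon := 'X_{1..n}.
Local Notation T := {mpoly K[N]}.

(** The exponent of the image of the monomial u under the substitution of
    x_(iota s) ^ (l s) for x_s. *)
Definition mnm_scale (u : mon) : 'X_{1..N} :=
  (\sum_(s < n) U_(iota s) *+ (l s * u s))%MM.

(** The largest exponent u whose image under [mnm_scale] divides w; see
    [mnm_scale_le]. *)
Definition mnm_quot (w : 'X_{1..N}) : mon :=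
  [multinom (w (iota s) %/ l s)%N | s < n].

Lemma mnm_scaleE u i : mnm_scale u i = (\sum_(s < n | iota s == i) l s * u s)%N.
Proof.
rewrite mnm_sumE [RHS]big_mkcond /=; apply: eq_bigr => s _.
by rewrite mulmnE mnm1E; case: (iota s == i); rewrite ?mul1n.
Qed.

Lemma mnm_scale_iota u s : mnm_scale u (iota s) = (l s * u s)%N.
Proof. by rewrite mnm_scaleE (big_pred1 s) // => k; rewrite (inj_eq iotaI). Qed.

Lemma mnm_scaleD u v : mnm_scale (u + v) = (mnm_scale u + mnm_scale v)%MM.
Proof.
apply/mnmP => i; rewrite mnmDE !mnm_scaleE -big_split /=.
by apply: eq_bigr => s _; rewrite mnmDE mulnDr.
Qed.

(** The adjunction between [mnm_scale] and [mnm_quot]: a row vector of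
    monomials of total degree z over the large ring is the same as an element
    of degree [mnm_quot z] of the multigraded module. *)
Lemma mnm_scale_le u w : (mnm_scale u <= w)%MM = (u <= mnm_quot w)%MM.
Proof.
apply/mnm_lepP/mnm_lepP => h => [s|i].
  by rewrite mnmE leq_divRL // mulnC -mnm_scale_iota.
have [/existsP[s /eqP <-]|/existsPn ne] := boolP [exists s, iota s == i].
  by have := h s; rewrite mnmE leq_divRL // mulnC mnm_scale_iota.
by rewrite mnm_scaleE big_pred0 // => s; apply: negPf (ne s).
Qed.

Lemma mnm_scale_sub u v :
  (v <= u)%MM -> (mnm_scale (u - v) + mnm_scale v)%MM = mnm_scale u.
Proof. by move=> h; rewrite -mnm_scaleD submK. Qed.

Lemma mdeg_mnm_scale u : mdeg (mnm_scale u) = (\sum_s l s * u s)%N.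
Proof. by rewrite mdeg_sum; apply: eq_bigr => s _;
  rewrite mdegMn mdeg1 mul1n. Qed.

Section Monomial.
Variables (r s : nat) (a : 'I_r -> mon) (b : 'I_s -> mon) (C : 'M[K]_(r, s)).

Definition mnm_matrix : 'M[T]_(r, s) :=
  \matrix_(i, j) (C i j *: 'X_[mnm_scale (a i - b j)]).

Definition homogeneous := forall i j, C i j != 0 -> (b j <= a i)%MM.
End Monomial.

(** The scalars of the component of total multidegree z of a row vector, where
    the coordinate j is shifted by the degree b_j. *)
Definition mdeg_part s (b : 'I_s -> mon) z (rho : 'rV[T]_s) : 'rV[K]_s :=
  \row_j if (b j <= mnm_quot z)%MM then (rho 0 j)@_(z - mnm_scale (b j)) else 0.

Lemma mdeg_part_below s (b : 'I_s -> mon) z rho :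
  below b (mnm_quot z) (mdeg_part b z rho).
Proof. by move=> j; rewrite mxE; case: ifP; rewrite ?eqxx. Qed.

Lemma mdeg_part_inj s (b : 'I_s -> mon) rho sig :
  (forall z, mdeg_part b z rho = mdeg_part b z sig) -> rho = sig.
Proof.
move=> h; apply/rowP => j; apply/mpolyP => w.
have /rowP/(_ j) := h (w + mnm_scale (b j))%MM.
by rewrite !mxE -mnm_scale_le lem_addl addmK.
Qed.

Lemma mdeg_part_mulmx r s (a : 'I_r -> mon) (b : 'I_s -> mon) C z tau :
  homogeneous a b C ->
  mdeg_part b z (tau *m mnm_matrix a b C) = mdeg_part a z tau *m C.
Proof.
move=> hC; apply/rowP => j; rewrite !mxE raddf_sum /=.
transitivity (\sum_i if (b j <= mnm_quot z)%MM
    then (tau 0 i * mnm_matrix a b C i j)@_(z - mnm_scale (b j)) else 0).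
  by case: ifP => // _; rewrite big1.
apply: eq_bigr => i _; rewrite !mxE.
have [->|nz] := eqVneq (C i j) 0;
  first by rewrite scale0r !mulr0 mcoeff0 if_same.
have ba := hC _ _ nz; rewrite -scalerAr mcoeffZ mulrC [tau 0 i * _]mulrC
  mcoeffMXl.
have e : mnm_scale (a i) = (mnm_scale (a i - b j) + mnm_scale (b j))%MM by
  rewrite mnm_scale_sub.
case: ifP => hb; last first.
  by rewrite ifF ?mul0r //; apply: contraFF hb; apply: lepm_trans.
rewrite -mnm_scale_le in hb; rewrite -(mnm_scale_le (a i)) e.
have -> : (mnm_scale (a i - b j) <= z - mnm_scale (b j))%MM =
  (mnm_scale (a i - b j) + mnm_scale (b j) <= z)%MM.
  apply/mnm_lepP/mnm_lepP => h x; have := h x; move/mnm_lepP: hb => /(_ x);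
  rewrite !(mnmBE, mnmDE); lia.
by case: ifP => _; rewrite ?mul0r // submDA [X in (z - X)%MM]addmC.
Qed.

(** The image of the matrix is multigraded, so membership can be tested and
    solved one multidegree at a time; only finitely many multidegrees occur in
    a given row vector. *)
Lemma generates_image r s (V : mon -> 'rV[K]_s -> Prop) (a : 'I_r -> mon)
    (b : 'I_s -> mon) C rho :
  generates V a C -> homogeneous a b C ->
  (forall z, V (mnm_quot z) (mdeg_part b z rho)) <->
  exists tau, rho = tau *m mnm_matrix a b C.
Proof.
move=> gV hC; split=> [Vrho|[tau ->] z]; last first.
  by rewrite mdeg_part_mulmx //; apply/gV; exists (mdeg_part a z tau) => //;
    apply: mdeg_part_below.
have [c bc ec] : exists2 c : 'X_{1..N} -> 'rV[K]_r,
    forall z, below a (mnm_quot z) (c z) & forall z, mdeg_part b z rho =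
      c z *m C.
  have h z : exists d, below a (mnm_quot z) d /\ mdeg_part b z rho = d *m C.
    by have [d] := iffLR (gV _ _) (Vrho z); exists d.
  exists (fun z => sval (constructive_indefinite_description _ (h z))) => z;
  by case: (svalP (constructive_indefinite_description _ (h z))).
(* All multidegrees in which rho has a nonzero component. *)
pose S := undup (flatten [seq
  [seq (w + mnm_scale (b j))%MM | w <- msupp (rho 0 j)] | j <- enum 'I_s]).
have inS z : z \notin S -> mdeg_part b z rho = 0.
  move=> nz; apply/rowP => j; rewrite !mxE; case: ifP => // hb.
  apply/memN_msupp_eq0; apply: contra nz => hw; rewrite mem_undup.
  apply/flatten_mapP; exists j; first by rewrite mem_enum.
  by apply/mapP; exists (z - mnm_scale (b j))%MM => //;
    rewrite submK // mnm_scale_le.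
exists (\row_i \sum_(z <- S) c z 0 i *: 'X_[z - mnm_scale (a i)]).
apply: (@mdeg_part_inj _ b) => z; rewrite mdeg_part_mulmx // ec.
have [zS|zS] := boolP (z \in S).
  congr (_ *m C); apply/rowP => i; rewrite !mxE raddf_sum /=.
  case: ifPn => hz; last first.
    by apply: contraNeq hz => /bc.
  rewrite (bigD1_seq z) ?undup_uniq //= mcoeffZ mcoeffX eqxx mulr1 big1 ?addr0
    //.
  move=> y ny; rewrite mcoeffZ mcoeffX.
  have [->|/bc hy] := eqVneq (c y 0 i) 0; first by rewrite mul0r.
  case: eqP; rewrite ?mulr0 // => e; case/eqP: ny.
  by rewrite -(submK (m := mnm_scale (a i)) (m' := y)) ?mnm_scale_le // e submK
    ?mnm_scale_le.
rewrite -ec inS //; apply/esym.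
suff -> : mdeg_part a z (\row_i \sum_(z0 <- S) c z0 0 i *:
  'X_[z0 - mnm_scale (a i)]) = 0 by rewrite mul0mx.
apply/rowP => i; rewrite !mxE; case: ifP => // hz.
rewrite raddf_sum big_seq big1 // => y hy /=; rewrite mcoeffZ mcoeffX.
have [->|/bc hy'] := eqVneq (c y 0 i) 0; first by rewrite mul0r.
case: eqP; rewrite ?mulr0 // => e; case/negP: zS.
by rewrite -(submK (m := mnm_scale (a i)) (m' := z)) ?mnm_scale_le // -e submK
  ?mnm_scale_le.
Qed.

Variables (Theta : {linear T -> T}) (f : 'I_n -> T).
Hypothesis Theta_inj : injective Theta.
Hypothesis Theta_surj : forall t, exists t0, t = Theta t0.
Hypothesis f_homog : forall s, f s \is (l s).-homog.
Hypothesis Theta_f : forall s t, Theta ('X_(iota s) ^+ l s * t) = f s * Theta t.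

Definition fpow (u : mon) : T := \prod_(s < n) f s ^+ u s.

(** Theta intertwines the substitution of powers of variables with the
    substitution of the f_s, for all monomials. *)
Lemma Theta_fpow u t : Theta ('X_[mnm_scale u] * t) = fpow u * Theta t.
Proof.
have powf s k x : Theta ('X_(iota s) ^+ (l s * k) * x) = f s ^+ k * Theta x.
  elim: k x => [|k ih] x; first by rewrite muln0 !mul1r.
  by rewrite mulnS exprD -mulrA Theta_f ih exprS mulrA.
rewrite /mnm_scale -mprodXE /fpow.
elim: (index_enum 'I_n) => [|s r ih]; first by rewrite !big_nil !mul1r.
by rewrite !big_cons -!mulrA -mpolyXn powf ih.
Qed.

Lemma fpow_homog u : fpow u \is (mdeg (mnm_scale u)).-homog.
Proof.
by rewrite mdeg_mnm_scale; apply: prod_homog.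
Qed.

Definition pushforward r s (a : 'I_r -> mon) (b : 'I_s -> mon)
  (C : 'M[K]_(r, s)) : 'M[T]_(r, s) :=
  \matrix_(i, j) (C i j *: fpow (a i - b j)).

Lemma map_pushforward r s (a : 'I_r -> mon) (b : 'I_s -> mon) C
    (tau : 'rV[T]_r) :
  map_mx Theta (tau *m mnm_matrix a b C) =
  map_mx Theta tau *m pushforward a b C.
Proof.
apply/rowP => j; rewrite !mxE raddf_sum; apply: eq_bigr => i _ /=.
by rewrite !mxE -!scalerAr linearZ /= mulrC Theta_fpow mulrC.
Qed.

Lemma map_surj r (rho : 'rV[T]_r) : exists rho0, rho = map_mx Theta rho0.
Proof.
have /fin_all_exists [t ht] j : exists t, rho 0 j = Theta t by [].
by exists (\row_j t j); apply/rowP => j; rewrite !mxE.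
Qed.

Lemma map_injective r : injective (map_mx Theta : 'rV[T]_r -> 'rV[T]_r).
Proof.
move=> x y /rowP h; apply/rowP => j; apply: Theta_inj.
by have := h j; rewrite !mxE.
Qed.

Lemma pushforward_image r s (a : 'I_r -> mon) (b : 'I_s -> mon) C
  (rho : 'rV[T]_s) :
  (exists tau, map_mx Theta rho = tau *m pushforward a b C) <->
  (exists tau, rho = tau *m mnm_matrix a b C).
Proof.
split=> [[tau e]|[tau ->]]; last by exists (map_mx Theta tau);
  rewrite map_pushforward.
have [t et] := map_surj tau; exists t; apply: map_injective.
by rewrite map_pushforward -et.
Qed.

(** Exactness is transported along Theta to the monomial matrices, and there it
    is the exactness in each multidegree. *)
Lemma pushforward_exact r' r s (a' : 'I_r' -> mon) (a : 'I_r -> mon)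
    (b : 'I_s -> mon) C' C (rho : 'rV[T]_r) :
  generates (relation a C) a' C' -> homogeneous a' a C' -> homogeneous a b C ->
  rho *m pushforward a b C = 0 <-> exists tau, rho = tau *m pushforward a' a C'.
Proof.
move=> gC hC' hC; have [rho0 ->] := map_surj rho.
rewrite pushforward_image -(generates_image rho0 gC hC') -map_pushforward.
split=> [e z|h].
  split; first exact: mdeg_part_below.
  rewrite -(mdeg_part_mulmx z rho0 hC).
  have -> : rho0 *m mnm_matrix a b C = 0 by apply: map_injective;
    rewrite e map_mx0.
  by apply/rowP => j; rewrite !mxE mcoeff0 if_same.
suff -> : rho0 *m mnm_matrix a b C = 0 by rewrite map_mx0.
apply: (@mdeg_part_inj _ b) => z; rewrite (mdeg_part_mulmx z rho0 hC).
by case: (h z) => _ ->; apply/rowP => j; rewrite !mxE mcoeff0 if_same.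
Qed.

Lemma irrelevant_of_coef0 (g : T) : g@_0%MM = 0 -> irrelevant_ideal g.
Proof.
move=> g0; pose s := msupp g.
have hs (k : 'I_(size s)) : exists i, (tnth (in_tuple s) k) i != 0%N.
  have: tnth (in_tuple s) k \in s by apply: mem_tnth.
  rewrite mcoeff_msupp; move: (tnth _ _) => u nz.
  have [/existsP[i hi]|/existsPn h] := boolP [exists i, u i != 0%N].
    by exists i.
  case/eqP: nz; rewrite (_ : u = 0%MM) //; apply/mnmP => i.
  by rewrite mnm0E; apply/eqP; rewrite -[_ == _]negbK; apply: h.
have [i hi] := fin_all_exists hs.
exists (size s), (fun k => g@_(tnth (in_tuple s) k) *:
  'X_[tnth (in_tuple s) k - U_(i k)]),
  (fun k => 'X_(i k)); split=> [k|]; first by exists (i k).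
rewrite [LHS]mpolyE big_tnth; apply: eq_bigr => k _.
by rewrite -scalerAl -mpolyXD submK // lep1mP.
Qed.

Definition pushforward_complex (M : mcomplex K n) : free_complex K N :=
  @FreeComplex K N (mrk M) (fun h i => (mdeg (mnm_scale (@mdegs _ _ M h i)))%:Z)
    (pushforward (@mdegs _ _ M 0) (fun=> 0%MM) (maug M))
    (fun h => pushforward (@mdegs _ _ M h.+1) (@mdegs _ _ M h) (mbdry M h)).

Variables (J : mon -> Prop) (I : T -> Prop).
Hypothesis I_image : forall g, I g <->
  exists2 t, g = Theta t & forall w, w \in msupp t -> J (mnm_quot w).

(** The substitution x_s := f_s turns a multigraded minimal resolution of a
    monomial ideal into a minimal graded resolution of its extension. The
    bijection Theta expresses that the target ring is free over the image of
    the substitution: it carries the evident decomposition for x_s := x_(iota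
    s) ^ (l s), where exponents are divided with remainder, to the one for the
    f_s. A generator of degree u goes to one of degree sum of l_s u_s, and the
    entries stay in the irrelevant ideal since the l_s are positive. *)
Theorem base_change M :
  mresolves J M -> minimal_graded_free_resolution I (pushforward_complex M).
Proof.
case=> gA g0 gS m0 mS.
have scale0 : mnm_scale 0%MM = 0%MM.
  by apply/eqP; rewrite -mdeg_eq0 mdeg_mnm_scale big1 // => s _;
    rewrite mnm0E muln0.
have homA : homogeneous (@mdegs _ _ M 0) (fun _ : 'I_1 => 0%MM) (maug M).
  by move=> i j _; apply/mnm_lepP => x; rewrite mnm0E.
have homS h : homogeneous (@mdegs _ _ M h.+1) (@mdegs _ _ M h) (mbdry M h).
  (* The matrix of the previous stage is the augmentation when h = 0. *)
  move=> i j nz; have [b _] : relation (@mdegs _ _ M h)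
      (if h is h'.+1 as k return
        'M[K]_(mrk M k, if k is k'.+1 then mrk M k' else 1)
       then mbdry M h' else maug M) (@mdegs _ _ M h.+1 i) (row i (mbdry M h)).
    by case: h i j nz => [|h] i j _;
      [exact: generates_row g0|exact: generates_row (gS h)].
  by apply: b; rewrite mxE.
have minS h i j : mbdry M h i j != 0 -> @mdegs _ _ M h.+1 i <> @mdegs _ _ M h j.
  move=> nz e; case/eqP: nz; case: h i j e => [|h] i j e.
    have := m0 _ _ (generates_row i g0) j (esym e).
    by rewrite mxE.
  have := mS h _ _ (generates_row i (gS h)) j (esym e).
  by rewrite mxE.
have graded r s (a : 'I_r -> mon) (b : 'I_s -> mon) C i j : homogeneous a b C ->
    graded_entry (mdeg (mnm_scale (a i)))%:Z (mdeg (mnm_scale (b j)))%:Z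
      (pushforward a b C i j).
  move=> hC u; rewrite mxE; have [->|nz] := eqVneq (C i j) 0.
    by rewrite scale0r msupp0.
  rewrite -(mnm_scale_sub (hC _ _ nz)) mdegD PoszD => hu.
  by rewrite (dhomogP _ _ _ (dhomogZ _ (fpow_homog _)) u hu).
split; [split|split|].
- move=> i j; have := @graded _ _ _ (fun=> 0%MM) _ i j homA.
  by rewrite scale0 mdeg0.
- move=> h i j; exact: graded (homS h).
- move=> g; rewrite I_image.
  have [rho0 e0] := map_surj (g%:M : 'rV_1).
  transitivity (exists tau, rho0 = tau *m mnm_matrix (@mdegs _ _ M 0)
    (fun _ : 'I_1 => 0%MM) (maug M)); last first.
    by rewrite e0 /=; symmetry; apply: pushforward_image.
  have gE : g = Theta (rho0 0 0).
    by move/matrixP: e0 => /(_ 0 0); rewrite !mxE eqxx mulr1n.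
  rewrite -(generates_image rho0 gA homA); split=> [[t et ht] z|h].
    have {}et : rho0 0 0 = t by apply: Theta_inj; rewrite -gE.
    rewrite /monomial_ideal.
    have [hz|hz] := boolP (z \in msupp t); [by right; apply: ht|left].
    apply/rowP => j; rewrite !mxE ord1 et scale0 subm0 (memN_msupp_eq0 hz).
    by rewrite if_same.
  exists (rho0 0 0) => // w; rewrite mcoeff_msupp => nz.
  case: (h w) => // /rowP /(_ 0); rewrite !mxE scale0 subm0 => e.
  move: e nz; case: ifP => [_ ->|]; first by rewrite eqxx.
  by move/negP; case; apply/mnm_lepP => x; rewrite mnm0E.
- by move=> v /=; apply: pushforward_exact.
- by move=> h v /=; apply: pushforward_exact.
move=> h i j; apply: irrelevant_of_coef0; rewrite /= mxE.
have [->|nz] := eqVneq (mbdry M h i j) 0; first by rewrite scale0r mcoeff0.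
rewrite mcoeffZ; apply/eqP; rewrite mulf_eq0 (negPf nz) /=.
have := fpow_homog (@mdegs _ _ M h.+1 i - @mdegs _ _ M h j)%MM.
set a := mdegs i; set b := mdegs j => hf.
rewrite mcoeff_eq0; apply/negP => /(dhomogP _ _ _ hf) e.
have {e} : mdeg (mnm_scale (a - b)%MM) = 0%N by rewrite -[LHS]e; apply: mdeg0.
move/eqP; rewrite mdeg_mnm_scale sum_nat_eq0 => /forallP /= ab0.
apply: (minS _ _ _ nz); apply/mnmP => s; apply/eqP; rewrite eqn_leq.
have /mnm_lepP/(_ s) -> := homS _ _ _ nz; rewrite andbT -subn_eq0.
by have := ab0 s; rewrite muln_eq0 -mnmBE eqn0Ngt l_gt0.
Qed.

End BaseChange.

(** * Powers of ideals *)

Section IdealPowers.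
Variables (K : fieldType) (N : nat).
Local Notation T := {mpoly K[N]}.
Implicit Types (S : T -> Prop) (f g c : T).

Lemma ideal_gen_base S f : S f -> ideal_gen S f.
Proof. by move=> h; exists 1%N, (fun=> 1), (fun=> f);
  rewrite big_ord1 mul1r. Qed.

Lemma ideal_gen0 S : ideal_gen S 0.
Proof. by exists 0%N, (fun=> 0), (fun=> 0); split=> [[]//|];
  rewrite big_ord0. Qed.

Lemma ideal_genM S c f : ideal_gen S f -> ideal_gen S (c * f).
Proof.
case=> r [d [g [hg ->]]]; exists r, (fun i => c * d i), g; split=> //.
by rewrite mulr_sumr; apply: eq_bigr => i _; rewrite mulrA.
Qed.

Lemma ideal_genD S f g : ideal_gen S f -> ideal_gen S g -> ideal_gen S (f + g).
Proof.
case=> r [c [x [hx ->]]] [s [d [y [hy ->]]]].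
exists (r + s)%N, (fun i => match split i with inl j => c j | inr j => d j end),
  (fun i => match split i with inl j => x j | inr j => y j end); split.
  by move=> i; case: split.
by rewrite big_split_ord /=; congr (_ + _); apply: eq_bigr => i _;
  [rewrite (unsplitK (inl i))|rewrite (unsplitK (inr i))].
Qed.

Lemma ideal_gen_sum S I (r : seq I) (P : pred I) (F : I -> T) :
  (forall i, P i -> ideal_gen S (F i)) -> ideal_gen S (\sum_(i <- r | P i) F i).
Proof.
by move=> h; elim/big_ind: _ => //;
  [apply: ideal_gen0|move=> *; apply: ideal_genD].
Qed.

Lemma ideal_pow0 S f : ideal_pow S 0 f.
Proof.
rewrite -[f]mulr1; apply: ideal_genM; apply: ideal_gen_base.
by exists (fun=> 0) => [[]|] //; rewrite big_ord0.
Qed.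

Lemma ideal_powS S m g f : S g -> ideal_pow S m f -> ideal_pow S m.+1 (g * f).
Proof.
move=> hg [r [c [x [hx ->]]]]; rewrite mulr_sumr; apply: ideal_gen_sum => i _.
rewrite mulrCA; apply: ideal_genM; apply: ideal_gen_base.
have [y hy ->] := hx i.
exists (fun j => if unlift ord0 j is Some j' then y j' else g).
  by move=> j; case: unlift.
rewrite big_ord_recl unlift_none; congr (_ * _).
by apply: eq_bigr => j _; rewrite liftK.
Qed.

Lemma ideal_pow_pred S m f : ideal_pow S m.+1 f -> ideal_pow S m f.
Proof.
case=> r [c [x [hx ->]]]; apply: ideal_gen_sum => i _.
have [y hy ->] := hx i; rewrite big_ord_recl mulrA; apply: ideal_genM.
by apply: ideal_gen_base; exists (fun j => y (lift ord0 j)).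
Qed.

Lemma ideal_pow_le S m m' f : (m' <= m)%N -> ideal_pow S m f ->
  ideal_pow S m' f.
Proof.
move=> /subnK <-; elim: (m - m')%N => // d ih /ideal_pow_pred; exact: ih.
Qed.

(** Only the factors with s <> k lie in the ideal, so the factor of index k
    does not count. *)
Lemma ideal_pow_prod S n (k : 'I_n) (g : 'I_n -> T) (u : 'I_n -> nat) m c :
  (forall s, s != k -> S (g s)) -> (m <= \sum_(s < n | s != k) u s)%N ->
  ideal_pow S m (\prod_(s < n) g s ^+ u s * c).
Proof.
move=> hg hm; rewrite mulrC; apply: ideal_genM; apply: ideal_pow_le hm _.
elim: (index_enum 'I_n) => [|s r ih].
  by rewrite !big_nil; apply: ideal_pow0.
rewrite !big_cons; case: ifPn => [/hg hs|_]; last exact: ideal_genM.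
elim: (u s) => [|b ihb]; first by rewrite mul1r.
by rewrite exprS -mulrA addSn; apply: ideal_powS.
Qed.

(** Lower bounds for orders along an ideal: after a change of coordinates
    [sigma], a superadditive weight that is positive on the generators is at
    least m on the m-th power. *)
Lemma ideal_pow_weight N' (sigma : {rmorphism T -> {mpoly K[N']}})
    (wt : 'X_{1..N'} -> nat) S m f :
  (forall u v, (wt u + wt v <= wt (u + v)%MM)%N) ->
  (forall g, S g -> forall v, v \in msupp (sigma g) -> (0 < wt v)%N) ->
  ideal_pow (ideal_gen S) m f ->
  forall v, v \in msupp (sigma f) -> (m <= wt v)%N.
Proof.
move=> wtD hS.
have gen_wt (S' : T -> Prop) a :
    (forall g, S' g -> forall v, v \in msupp (sigma g) -> (a <= wt v)%N) ->
    forall g, ideal_gen S' g -> forall v, v \in msupp (sigma g) ->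
      (a <= wt v)%N.
  move=> hS' g [r [c [x [hx ->]]]] v.
  rewrite raddf_sum /= => /msupp_sum_le; case/flatten_mapP => i _.
  rewrite rmorphM => /msuppM_ex [a1 [a2 [_ /(hS' _ (hx i)) h ->]]].
  by apply: leq_trans (wtD _ _); apply: leq_trans h _; rewrite leq_addl.
apply: (gen_wt) => _ [g hg ->]; elim: m g hg => [//|m ih] g hg v.
rewrite big_ord_recl rmorphM => /msuppM_ex [v1 [v2 [h1 h2 ->]]].
apply: leq_trans (wtD _ _); rewrite -[m.+1]add1n leq_add //.
  exact: gen_wt hS _ (hg _) _ h1.
by apply: ih h2 => i; apply: hg.
Qed.

End IdealPowers.

(** * The fat coordinate points and the ideal Gamma *)

(** The monomials of the ideal of the m-fat coordinate points, the intersection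
    of the powers (x_s : s <> k)^m. *)
Definition star_monomials n m (u : 'X_{1..n}) : Prop :=
  forall k, (m <= \sum_(s < n | s != k) u s)%N.

(** Lowering to m the exponents that exceed m does not leave the ideal, which
    bounds the degrees of its generators. *)
Lemma star_resolution (K : fieldType) n m :
  exists M, mresolves (K := K) (@star_monomials n m) M.
Proof.
apply: (@mresolution K n _ [multinom m | _ < n]) =>
  [u v /mnm_lepP uv hu k|u hu k].
  by apply: leq_trans (hu k) _; apply: leq_sum.
have [/existsP[s /andP[sk ms]]|/existsPn h] :=
    boolP [exists s, (s != k) && (m <= u s)%N].
  by rewrite (bigD1 s) //= !mnmE (minn_idPr ms) leq_addr.
apply: leq_trans (hu k) _; apply: leq_sum => s sk;
  rewrite !mnmE leq_min leqnn /=.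
by have := h s; rewrite sk /= -ltnNge => /ltnW.
Qed.

Section Star.
Variables (K : fieldType) (n N : nat) (iota : 'I_n -> 'I_N) (l : 'I_n -> nat).
Hypothesis iotaI : injective iota.
Hypothesis l_gt0 : forall s, (0 < l s)%N.
Local Notation T := {mpoly K[N]}.
Variables (Theta : {linear T -> T}) (f : 'I_n -> T).
Hypothesis Theta_f : forall s t, Theta ('X_(iota s) ^+ l s * t) = f s * Theta t.

(** Dividing exponents with remainder writes the image of a monomial as a
    multiple of a product of powers of the f_s. *)
Lemma Theta_ideal_pow (S : T -> Prop) m k t :
  (forall s, s != k -> ideal_gen S (f s)) ->
  (forall w, w \in msupp t ->
    (m <= \sum_(s < n | s != k) mnm_quot iota l w s)%N) ->
  ideal_pow (ideal_gen S) m (Theta t).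
Proof.
move=> hS ht; rewrite [t]mpolyE linear_sum big_seq; apply: ideal_gen_sum =>
  w /ht hw.
rewrite linearZ /= -mul_mpolyC; apply: ideal_genM.
have e : (mnm_scale iota l (mnm_quot iota l w) <= w)%MM by rewrite mnm_scale_le
  ?lepm_refl.
rewrite -(submK e) addmC mpolyXD (Theta_fpow Theta_f).
exact: ideal_pow_prod hS hw.
Qed.

End Star.

(** Here Theta is the identity, since the target ring is visibly free over the
    powers of the variables. *)
Lemma Gamma_star (K : fieldType) n (l : 'I_n -> nat) m (g : {mpoly K[n]}) :
  (forall s, (0 < l s)%N) ->
  Gamma l m g <->
  exists2 t, g = t &
    forall w, w \in msupp t -> star_monomials m (mnm_quot id l w).
Proof.
move=> l_gt0; split=> [hg|[_ <- hg] k]; last first.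
  apply: (@Theta_ideal_pow _ _ _ id l _ _ idfun (fun s => 'X_s ^+ l s) _ _ _ k)
    => // [s sk|w /hg //].
  by apply: ideal_gen_base; exists s.
exists g => // w hw k.
rewrite (eq_bigr (fun s => w s %/ l s)%N) => [|s _]; last by rewrite mnmE.
apply: (@ideal_pow_weight _ _ _ idfun (fun v : 'X_{1..n} =>
  \sum_(s < n | s != k) v s %/ l s)%N _ _ _ _ _ (hg k)) =>
  // [u v|h [i ik ->] v].
  rewrite -big_split leq_sum // => s _ /=; rewrite mnmDE leq_divRL //.
  by rewrite mulnDl leq_add ?leq_trunc_div.
rewrite /= mpolyXn msuppX inE => /eqP ->.
by rewrite (bigD1 i) //= mulmnE mnm1E eqxx mul1n divnn l_gt0.
Qed.

(** * Linear substitutions and general points *)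

Section LinearSubstitution.
Variables (K : fieldType) (n : nat).
Local Notation T := {mpoly K[n]}.
Implicit Types (A B : 'M[K]_n) (f g : T).

(** The substitution is set up so that evaluating [lsub A f] at the row vector
    x evaluates f at x *m A; composition then follows matrix products. *)
Definition lsub A f : T := f \mPo [tuple \sum_i A i j *: 'X_i | j < n].

HB.instance Definition _ A :=
  GRing.Linear.copy (lsub A) (comp_mpoly [tuple \sum_i A i j *: 'X_i | j < n]).
HB.instance Definition _ A :=
  GRing.RMorphism.copy (lsub A)
  (comp_mpoly [tuple \sum_i A i j *: 'X_i | j < n]).

Lemma lsubE A f :
  lsub A f = \sum_(u <- msupp f) f@_u *: \prod_j (\sum_i A i j *: 'X_i) ^+ u j.
Proof.
rewrite /lsub comp_mpolyEX; apply: eq_bigr => u _; rewrite comp_mpolyX.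
by congr (_ *: _); apply: eq_bigr => j _; rewrite tnth_mktuple.
Qed.

Lemma lsubX A j : lsub A 'X_j = \sum_i A i j *: 'X_i.
Proof. by rewrite /lsub comp_mpolyXU -tnth_nth tnth_mktuple. Qed.

Lemma lsubZ A c f : lsub A (c *: f) = c *: lsub A f.
Proof. exact: comp_mpolyZ. Qed.

Lemma lsubM A B f : lsub A (lsub B f) = lsub (A *m B) f.
Proof.
rewrite [in LHS](lsubE B) [RHS]lsubE (raddf_sum (lsub A)); apply: eq_bigr =>
  u _.
rewrite /= lsubZ (rmorph_prod (lsub A)) /=; congr (_ *: _); apply: eq_bigr =>
  j _ /=.
rewrite (rmorphXn (lsub A)) /= (raddf_sum (lsub A)) /=; congr (_ ^+ _).
under eq_bigr => i _ do rewrite lsubZ /= lsubX scaler_sumr.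
rewrite exchange_big; apply: eq_bigr => i _ /=.
by rewrite mxE scaler_suml; apply: eq_bigr => k _; rewrite scalerA mulrC.
Qed.

Lemma lsub1 f : lsub 1%:M f = f.
Proof.
rewrite lsubE [RHS]mpolyE; apply: eq_bigr => u _; congr (_ *: _).
rewrite [RHS]mpolyXE_id; apply: eq_bigr => j _; congr (_ ^+ _).
rewrite (bigD1 j) //= mxE eqxx scale1r big1 ?addr0 // => i /negPf ij.
by rewrite mxE ij scale0r.
Qed.

Lemma lsub_eval A f (x : 'rV[K]_n) : (lsub A f).@[x 0] = f.@[(x *m A) 0].
Proof.
rewrite /lsub comp_mpoly_meval; apply: meval_eq => j; rewrite tnth_mktuple mxE.
rewrite raddf_sum; apply: eq_bigr => i _ /=.
by rewrite mevalZ mevalXU mulrC.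
Qed.

Lemma linear_form_homog (c : 'I_n -> K) :
  \sum_i c i *: ('X_i : T) \is 1.-homog.
Proof. by apply: rpred_sum => i _; apply: rpredZ; rewrite dhomogX; apply/eqP;
  apply: mdeg1. Qed.

Lemma lsub_homog A d f : f \is d.-homog -> lsub A f \is d.-homog.
Proof.
move=> hf; rewrite lsubE big_seq; apply: rpred_sum => u hu.
have <- : mdeg u = d := dhomogP _ _ _ hf _ hu.
have -> : mdeg u = (\sum_j 1 * u j)%N.
  by rewrite mdegE; apply: eq_bigr => j _; rewrite mul1n.
apply: rpredZ; apply: (prod_homog (d := fun=> 1%N)) => j.
exact: linear_form_homog.
Qed.

End LinearSubstitution.

Section GeneralPoints.
Variables (K : fieldType) (n m : nat) (p : 'I_n -> 'rV[K]_n).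
Hypothesis hp : general_points p.

Definition points_mx : 'M[K]_n := \matrix_i p i.

(** A vector in the kernel of the transpose would give a hyperplane that
    contains all the points. *)
Lemma points_unit : points_mx \in unitmx.
Proof.
case: hp => _ hU; apply: contra_notT hU => nu.
have [v vP nv] : exists2 v : 'rV[K]_n, v *m points_mx^T = 0 & v != 0.
  have : kermx points_mx^T != 0 by rewrite kermx_eq0 -unitmx_tr row_free_unit in
    nu *.
  by case/rowV0Pn => v /sub_kermxP h nv; exists v.
pose phi := linfun (mulmxr v^T : 'rV[K]_n -> 'rV[K]_1).
exists (lker phi) => [|i].
  have := limg_ker_dim phi fullv; rewrite capfv dimvf /dim /= mul1n => e.
  rewrite -[X in (_ < X)%N]e -[X in (X < _)%N]addn0 ltn_add2l lt0n dimv_eq0.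
  apply: contra nv => /eqP im0; apply/eqP/rowP => j; rewrite mxE.
  have : phi (delta_mx 0 j) \in limg phi by apply: memv_img; apply: memvf.
  rewrite im0 memv0 lfunE /= => /eqP /matrixP /(_ 0 0).
  by rewrite -rowE !mxE.
rewrite memv_ker lfunE /=; apply/eqP/matrixP => a b.
have /matrixP /(_ 0 i) := vP; rewrite !mxE !ord1 => h; rewrite -[RHS]h.
by apply: eq_bigr => j _; rewrite !mxE mulrC.
Qed.

(** In the coordinates given by the points the fat points become the fat
    coordinate points. The linear form of index s vanishes at all the points
    but the s-th. *)
Lemma points_star (g : {mpoly K[n]}) :
  fat_points_ideal p m g <->
  exists2 t, g = lsub (invmx points_mx) t &
    forall w, w \in msupp t -> star_monomials m (mnm_quot id (fun=> 1%N) w).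
Proof.
have uP := points_unit; split=> [hg|[t -> ht] k].
  exists (lsub points_mx g); first by rewrite lsubM mulVmx // lsub1.
  move=> w hw k; rewrite (eq_bigr (fun s => w s)) => [|s _];
    last by rewrite mnmE divn1.
  apply: (@ideal_pow_weight _ _ _ (lsub points_mx) (fun v : 'X_{1..n} =>
    \sum_(s < n | s != k) v s)%N _ _ _ _ _ (hg k)) => // [u v|h [[d hd] hv] v].
    by rewrite -big_split leq_sum // => s _ /=; rewrite mnmDE.
  have hh := lsub_homog points_mx hd; move=> vs; rewrite lt0n; apply/negP =>
    /eqP v0.
  (* The only monomial of degree d and weight 0 is a power of x_k, and its
     coefficient is the value at the k-th coordinate point. *)
  have ev : v = (U_(k) *+ d)%MM.
    have vd : mdeg v = d := dhomogP _ _ _ hh _ vs.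
    have vz s : s != k -> v s = 0%N.
      by move=> sk; apply/eqP; move/eqP: v0; rewrite sum_nat_eq0 =>
        /forall_inP /(_ s sk).
    apply/mnmP => s; rewrite mulmnE mnm1E -vd mdegE (bigD1 k) //= big1 ?addn0
      //.
    by have [->|/vz ->] := eqVneq s k; rewrite ?eqxx ?mul1n // eq_sym;
      case: eqP.
  have : (lsub points_mx h).@[(delta_mx 0 k : 'rV_n) 0] = 0.
    by rewrite lsub_eval -rowE rowK; apply: hv; apply: memv_line.
  rewrite mevalE (bigD1_seq v) ?msupp_uniq //= [X in _ + X]big1_seq ?addr0 =>
    [|y /andP[yv ys]].
    rewrite big1 ?mulr1 => [/eqP|s _]; first by rewrite mcoeff_eq0 vs.
    by rewrite mxE ev mulmnE mnm1E eqxx eq_sym /=; case: eqP;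
      rewrite ?expr1n ?mul0n ?expr0.
  apply/eqP; rewrite mulf_eq0; apply/orP; right.
  have [s sk ys0] : exists2 s, s != k & y s != 0%N.
    apply/exists_inP; apply: contraNT yv => /exists_inPn hy.
    have yz s : s != k -> y s = 0%N by move=> sk; apply/eqP;
      rewrite -[_ == _]negbK; apply: hy.
    have yd : mdeg y = d := dhomogP _ _ _ hh _ ys.
    apply/eqP/mnmP => s; rewrite ev mulmnE mnm1E -yd mdegE (bigD1 k) //= big1
      ?addn0 //.
    by have [->|/yz ->] := eqVneq s k; rewrite ?eqxx ?mul1n // eq_sym;
      case: eqP.
  by rewrite (bigD1 s) //= mxE eqxx (negPf sk) expr0n (negPf ys0) mul0r.
apply: (@Theta_ideal_pow _ _ _ id (fun=> 1%N) _ _ (lsub (invmx points_mx))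
  (fun s => lsub (invmx points_mx) 'X_s) _ _ _ k) => //.
- by move=> s x; rewrite rmorphM.
- move=> s sk; apply: ideal_gen_base; split.
    by exists 1%N; apply: lsub_homog; rewrite dhomogX; apply/eqP; apply: mdeg1.
  have pk : p k = row k points_mx by rewrite rowK.
  move=> v /vlineP [c ->]; rewrite lsub_eval mevalXU.
  rewrite -scalemxAl mxE pk -row_mul mulmxV //.
  by rewrite !mxE eq_sym (negPf sk) mulr0.
by move=> w /ht.
Qed.

End GeneralPoints.

(** * The Newton basis of a grid *)

Section LinearExtension.
Variables (K : fieldType) (N : nat) (B : 'X_{1..N} -> {mpoly K[N]}).

Definition lin_ext (t : {mpoly K[N]}) : {mpoly K[N]} :=
  \sum_(w <- msupp t) t@_w *: B w.

Lemma lin_extE k t : (msize t <= k)%N ->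
  lin_ext t = \sum_(w : 'X_{1..N < k}) t@_w *: B w.
Proof.
move=> tk; rewrite /lin_ext (big_mksub ('X_{1..N < k} : subFinType _)) //=;
  first last.
- by move=> w /msize_mdeg_lt /leq_trans; apply.
- by rewrite msupp_uniq.
by rewrite big_rmcond //= => w /memN_msupp_eq0 ->; rewrite scale0r.
Qed.

Lemma lin_ext_linear : linear lin_ext.
Proof.
move=> c p q; pose k := maxn (msize (c *: p + q)) (maxn (msize p) (msize q)).
rewrite !(@lin_extE k) ?leq_max ?leqnn ?orbT // scaler_sumr -big_split.
by apply: eq_bigr => w _; rewrite mcoeffD mcoeffZ scalerDl scalerA.
Qed.

HB.instance Definition _ := GRing.isLinear.Build K {mpoly K[N]} {mpoly K[N]} _
  lin_ext lin_ext_linear.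

Lemma lin_extX w : lin_ext 'X_[w] = B w.
Proof. by rewrite /lin_ext msuppX big_seq1 mcoeffX eqxx scale1r. Qed.

End LinearExtension.

Section Grid.
Variables (K : fieldType) (n : nat) (l : 'I_n -> nat) (A : 'I_n -> seq K).
Hypothesis l_gt0 : forall s, (0 < l s)%N.
Hypothesis hA : grid_sets l A.
Local Notation N := n.+1.
Local Notation T := {mpoly K[N]}.
Local Notation X0 := ('X_(ord0 : 'I_N) : T).
Local Notation xs s := ('X_(lift (ord0 : 'I_N) s) : T).
Local Notation up := (lift (ord0 : 'I_N)).

(** The points of A_s, repeated periodically. *)
Definition node s i : K := (A s)`_(i %% l s).

Definition line_form s c : T := xs s + c *: X0.
Definition newton_poly s b : T := \prod_(0 <= i < b) line_form s (- node s i).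
(** Newton interpolation along the periodic nodes. The factor of index s is
    divisible by the power of exponent w_s %/ l_s of the product of the x_s - a
    x_0 with a in A_s, and by no higher power of a suitable one of these linear
    forms. This is why the ideals of the lines are spanned by basis elements,
    see [newton_key]. *)
Definition newton_basis (w : 'X_{1..N}) : T :=
  X0 ^+ w ord0 * \prod_s newton_poly s (w (up s)).

Definition newton := lin_ext newton_basis.

HB.instance Definition _ := GRing.Linear.on newton.

Lemma newtonZ c t : newton (c *: t) = c *: newton t.
Proof. exact: linearZ. Qed.

Lemma newtonD t u : newton (t + u) = newton t + newton u.
Proof. exact: raddfD. Qed.

Lemma line_form_homog s c : line_form s c \is 1.-homog.
Proof.
apply: rpredD; last apply: rpredZ; by rewrite dhomogX; apply/eqP; apply: mdeg1.
Qed.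

Lemma newton_poly_homog s b : newton_poly s b \is b.-homog.
Proof.
elim: b => [|b ih]; first by rewrite /newton_poly big_geq // dhomog1.
by rewrite /newton_poly big_nat_recr //= -[b.+1]addn1; apply: dhomogM => //;
  apply: line_form_homog.
Qed.

Lemma newton_basis_homog w : newton_basis w \is (mdeg w).-homog.
Proof.
rewrite mdegE big_ord_recl; apply: dhomogM.
  rewrite mpolyXn dhomogX; apply/eqP; apply: etrans (mdegMn _ _) _.
  by rewrite mdeg1 mul1n.
elim: (index_enum 'I_n) => [|s r ih]; first by rewrite !big_nil dhomog1.
by rewrite !big_cons; apply: dhomogM ih; apply: newton_poly_homog.
Qed.

Lemma newton_poly_period s b :
  newton_poly s (l s + b) = newton_poly s (l s) * newton_poly s b.
Proof.
rewrite /newton_poly (big_cat_nat (n := l s)) ?leq_addr //=; congr (_ * _).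
rewrite -[X in \prod_(X <= _ < _) _]add0n big_addn addKn.
by apply: eq_bigr => i _; rewrite /node modnDr.
Qed.

Lemma newtonX w : newton 'X_[w] = newton_basis w. Proof. exact: lin_extX. Qed.

(** The nodes have period l_s. *)
Lemma newton_f s t : newton (xs s ^+ l s * t) = newton_poly s (l s) * newton t.
Proof.
rewrite [t]mpolyE mulr_sumr !raddf_sum mulr_sumr /=; apply: eq_bigr => w _.
rewrite -scalerAr !linearZ /= -scalerAr; congr (_ *: _).
rewrite mpolyXn -mpolyXD !newtonX /newton_basis mnmDE mulmnE mnm1E /= mul0n
  add0n.
rewrite mulrCA; congr (_ * _); rewrite [LHS](bigD1 s) //= [in RHS](bigD1 s) //=
  mulrA.
rewrite mnmDE mulmnE mnm1E eqxx mul1n newton_poly_period; congr (_ * _).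
apply: eq_bigr => s' /negPf ss; rewrite mnmDE mulmnE mnm1E (inj_eq lift_inj).
by rewrite eq_sym ss mul0n.
Qed.

Lemma newton_X0 t : newton (X0 * t) = X0 * newton t.
Proof.
rewrite [t]mpolyE mulr_sumr !raddf_sum mulr_sumr /=; apply: eq_bigr => w _.
rewrite -scalerAr !linearZ /= -scalerAr; congr (_ *: _).
rewrite -mpolyXD !newtonX /newton_basis mnmDE mnm1E eqxx exprD expr1 -mulrA.
by congr (_ * (_ * _)); apply: eq_bigr => s _; rewrite mnmDE mnm1E.
Qed.

(** The image contains 1 and is an ideal: multiplying a factor by x_s gives the
    next Newton polynomial plus a multiple of x_0 times the factor. *)
Lemma newton_surj t : exists t0, t = newton t0.
Proof.
have im0 u : exists t0, X0 * newton u = newton t0.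
  by exists (X0 * u); rewrite newton_X0.
have imS s u : exists t0, xs s * newton u = newton t0.
  rewrite [u]mpolyE; elim: (msupp u) => [|w r [t1 ih]].
    by exists 0; rewrite big_nil !raddf0 mulr0.
  have [t2 e2] := im0 'X_[w].
  exists (u@_w *: ('X_[U_(up s) + w] + node s (w (up s)) *: t2) + t1).
  rewrite big_cons !(newtonD, newtonZ) mulrDr ih.
  congr (_ + _); rewrite -scalerAr -e2 !newtonX; congr (_ *: _).
  rewrite /newton_basis mnmDE mnm1E /= add0n mulrCA [X in _ = _ + _ *: X]mulrCA
    scalerAr -mulrDr.
  congr (_ * _); rewrite (bigD1 s) //= [X in _ = X + _](bigD1 s) //= scalerAl.
  have -> : \prod_(i < n | i != s) newton_poly i ((U_(up s) + w)%MM (up i)) =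
    \prod_(i < n | i != s) newton_poly i (w (up i)).
    by apply: eq_bigr => i /negPf si;
      rewrite mnmDE mnm1E (inj_eq lift_inj) eq_sym si.
  rewrite mnmDE mnm1E eqxx add1n !mulrA -mulrDl; congr (_ * _).
  rewrite /newton_poly big_nat_recr //= /line_form scaleNr mulrBr -scalerAr.
  by rewrite [X in _ = X - _ + _]mulrC [X in _ = _ - _ *: X + _]mulrC -scalerAl
    subrK.
have im i u : exists t0, 'X_i * newton u = newton t0.
  case: (unliftP ord0 i) => [s ->|->]; [exact: imS|exact: im0].
have im1 : exists t0, 1 = newton t0.
  exists 1; rewrite -mpolyX0 newtonX /newton_basis mnm0E mul1r big1 ?mpolyX0 //
    => s _.
  by rewrite mnm0E /newton_poly big_geq.
have imX w : exists t0, 'X_[w] = newton t0.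
  rewrite mpolyXE_id; elim: (index_enum 'I_N) => [|i r [t0 ih]].
    by rewrite big_nil.
  rewrite big_cons ih; elim: (w i) => [|b [t1 ihb]]; first by exists t0;
    rewrite mul1r.
  by rewrite exprS -mulrA ihb.
rewrite [t]mpolyE; elim: (msupp t) => [|w r [t0 ih]].
  by exists 0; rewrite big_nil raddf0.
have [t1 e1] := imX w; exists (t@_w *: t1 + t0).
by rewrite big_cons ih e1 linearP.
Qed.

Section Translation.
Variable alpha : 'I_n -> K.

(** Substitution of x_s + alpha_s x_0 for x_s, that is, translation by alpha in
    the affine chart x_0 = 1. *)
Definition shift_mx : 'M[K]_N := \matrix_(i, j)
  ((i == j)%:R + (i == ord0)%:R *
    (if unlift ord0 j is Some s then alpha s else 0)).

Lemma lsub_X0 : lsub shift_mx X0 = X0.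
Proof.
rewrite lsubX (bigD1 ord0) //= big1 ?addr0 => [|i /negPf i0].
  by rewrite mxE unlift_none mulr0 addr0 eqxx scale1r.
by rewrite mxE unlift_none mulr0 addr0 i0 scale0r.
Qed.

Lemma lsub_xs s : lsub shift_mx (xs s) = line_form s (alpha s).
Proof.
rewrite lsubX (bigD1 (up s)) //= mxE eqxx /= mul0r addr0 scale1r; congr (_ + _).
rewrite (bigD1 ord0) //= big1 ?addr0 => [|i /andP[/negPf iN /negPf i0]].
  by rewrite mxE liftK mul1r add0r.
by rewrite mxE iN i0 mul0r addr0 scale0r.
Qed.

Lemma lsub_line_form s c :
  lsub shift_mx (line_form s c) = line_form s (alpha s + c).
Proof.
by rewrite /line_form rmorphD /= lsubZ lsub_xs lsub_X0 /line_form -addrA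
  -scalerDl.
Qed.

(** The order at alpha_s of the Newton polynomial of degree b. *)
Definition hits s b := (\sum_(0 <= i < b) (alpha s == node s i))%N.

Definition shifted_newton s b : T :=
  \prod_(0 <= i < b) line_form s (alpha s - node s i).

Lemma lsub_newton_basis w : lsub shift_mx (newton_basis w) =
  X0 ^+ w ord0 * \prod_s shifted_newton s (w (up s)).
Proof.
rewrite /newton_basis rmorphM rmorphXn /= lsub_X0 rmorph_prod; congr (_ * _).
apply: eq_bigr => s _; rewrite rmorph_prod; apply: eq_bigr => i _.
exact: lsub_line_form.
Qed.

Lemma shifted_newton_low s b h v :
  v \in msupp (shifted_newton s b * h) -> (hits s b <= v (up s))%N.
Proof.
rewrite /shifted_newton /hits; elim: b h v => [|b ih] h v;
  first by rewrite [X in (X <= _)%N]big_geq.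
rewrite !big_nat_recr //= -mulrA; case: eqP => [e|_]; last first.
  by move=> /ih; rewrite addn0.
have {e} -> : alpha s - node s b = 0 by rewrite e subrr.
rewrite /line_form scale0r addr0 mulrCA => /msuppM_ex [a [b' [+ /ih hb ->]]].
by rewrite msuppX inE => /eqP ->; rewrite mnmDE mnm1E eqxx addnC leq_add2l.
Qed.

Lemma lsub_newton_basis_low w v s :
  v \in msupp (lsub shift_mx (newton_basis w)) ->
    (hits s (w (up s)) <= v (up s))%N.
Proof.
rewrite lsub_newton_basis (bigD1 s) //= mulrCA; exact: shifted_newton_low.
Qed.

Lemma mlead_line_form s c :
  mlead (line_form s c) = if c == 0 then U_(up s)%MM else U_(ord0)%MM.
Proof.
rewrite /line_form; case: eqP => [->|/eqP c0];
  first by rewrite scale0r addr0 mleadXm.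
rewrite mleadDr ?mleadZ // !mleadXm //.
apply/ltmcP; first by rewrite !mdeg1.
by exists ord0 => //; rewrite !mnm1E.
Qed.

Lemma line_form_neq0 s c : line_form s c != 0.
Proof.
apply/eqP => /(congr1 (mcoeff U_(up s)));
  rewrite mcoeffD mcoeffZ !mcoeffXU eqxx mulr0 addr0 mcoeff0.
by move/eqP; rewrite oner_eq0.
Qed.

Lemma shifted_newton_neq0 s b : shifted_newton s b != 0.
Proof. by rewrite /shifted_newton prodf_seq_neq0; apply/allP => i _;
  apply: line_form_neq0. Qed.

Lemma mlead_shifted_newton s b s' :
  mlead (shifted_newton s b) (up s') = ((s == s') * hits s b)%N.
Proof.
rewrite /shifted_newton mlead_prod => [|i _ _]; last exact: line_form_neq0.
rewrite mnm_sumE /hits big_distrr; apply: eq_bigr => i _ /=.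
rewrite mlead_line_form subr_eq0; case: ifP => _; rewrite mnm1E ?muln0 //.
by rewrite (inj_eq lift_inj) muln1.
Qed.

(** The variable x_0 is the largest one, so the leading monomial selects x_0 in
    every factor that does not vanish at alpha; the exponent of x_s that
    remains is the order. *)
Lemma mlead_lsub_newton_basis w s :
  mlead (lsub shift_mx (newton_basis w)) (up s) = hits s (w (up s)).
Proof.
have nzp : \prod_s shifted_newton s (w (up s)) != 0.
  by rewrite prodf_seq_neq0; apply/allP => i _; apply: shifted_newton_neq0.
have nz0 : X0 ^+ w ord0 != 0.
  by rewrite mpolyXn -msupp_eq0 msuppX.
rewrite lsub_newton_basis mleadM // mnmDE mpolyXn mleadXm mulmnE mnm1E mul0n
  add0n.
rewrite mlead_prod => [|i _ _]; last exact: shifted_newton_neq0.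
rewrite mnm_sumE (bigD1 s) //= mlead_shifted_newton eqxx mul1n big1 ?addn0 // =>
  i /negPf si.
by rewrite mlead_shifted_newton si.
Qed.

Lemma lsub_newton_basis_neq0 w : lsub shift_mx (newton_basis w) != 0.
Proof.
rewrite lsub_newton_basis mulf_neq0 //;
  first by rewrite mpolyXn -msupp_eq0 msuppX.
by rewrite prodf_seq_neq0; apply/allP => i _; apply: shifted_newton_neq0.
Qed.

Lemma hitsE s b i0 : (i0 < l s)%N -> alpha s = (A s)`_i0 ->
  hits s b = ((b + (l s - i0.+1)) %/ l s)%N.
Proof.
move=> il ea; have [uA sA] := hA s.
rewrite /hits; elim: b => [|b ih].
  rewrite big_geq // add0n divn_small //; lia.
rewrite big_nat_recr //= ih addSn divnS // addnC; congr (_ + _)%N;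
  congr (nat_of_bool _).
rewrite ea /node nth_uniq ?sA // ?ltn_mod ?l_gt0 //.
have -> : (b + (l s - i0.+1)).+1 = (b + l s - i0)%N by lia.
rewrite -eqn_mod_dvd; last by lia.
by rewrite modnDr (modn_small il) eq_sym.
Qed.

Lemma hits_ge s b : alpha s \in A s -> (b %/ l s <= hits s b)%N.
Proof.
case/(nthP 0) => i0; have [_ ->] := hA s => il ea.
by rewrite (hitsE b il (esym ea)) leq_div2r // leq_addr.
Qed.

(** Take for alpha_s the node that comes next after the b nodes already used:
    it was used exactly b %/ l_s times, and every longer product uses it once
    more. *)
Lemma hits_node s b : alpha s = node s b ->
  hits s b = (b %/ l s)%N /\ forall c, (b < c)%N -> (b %/ l s < hits s c)%N.
Proof.
move=> ea; have il : (b %% l s < l s)%N by rewrite ltn_mod.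
have E c := hitsE c il ea; split=> [|c bc]; rewrite E.
  have -> : (b + (l s - (b %% l s).+1) = b %/ l s * l s + (l s).-1)%N.
    by have := divn_eq b (l s); lia.
  by rewrite divnMDl // [((l s).-1 %/ _)%N]divn_small ?addn0 ?ltn_predL.
rewrite leq_divRL //; have := divn_eq b (l s); lia.
Qed.

End Translation.

(** If a polynomial has order at least m along all lines of the direction k,
    then so have the Newton basis elements that occur in it. Otherwise choose
    among the offending ones an element u for which the sum of the exponents of
    x_1, ..., x_n is least, and translate to the nodes that come next after u.
    There the leading monomial v of u does not occur in any other term: a good
    w has too large an order, and a bad one has a larger exponent in some x_s,
    hence by [hits_node] a larger order in x_s, unless it differs from u only
    in x_0 and so has another degree. But v has order less than m. *)
Lemma newton_key k m t :
  (forall alpha, (forall s, alpha s \in A s) ->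
     forall v, v \in msupp (lsub (shift_mx alpha) (newton t)) ->
     (m <= \sum_(s < n | s != k) v (up s))%N) ->
  forall w, w \in msupp t -> (m <= \sum_(s < n | s != k) w (up s) %/ l s)%N.
Proof.
move=> ht w0 w0t; rewrite leqNgt; apply/negP => w0bad.
pose bad (w : 'X_{1..N}) := (\sum_(s < n | s != k) w (up s) %/ l s < m)%N.
pose wt (w : 'X_{1..N}) := (\sum_s w (up s))%N.
have [u [ut ubad umin]] : exists u, [/\ u \in msupp t, bad u &
    forall w, w \in msupp t -> bad w -> (wt u <= wt w)%N].
  have ex : exists d, has (fun w => bad w && (wt w == d)) (msupp t).
    by exists (wt w0); apply/hasP; exists w0; rewrite // /bad w0bad eqxx.
  case: (ex_minnP ex) => d /hasP[u ut /andP[ub /eqP ud]] dmin.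
  exists u; split=> // w wst wb; rewrite ud; apply: dmin.
  by apply/hasP; exists w => //; rewrite wb eqxx.
pose alpha s := node s (u (up s)).
have alphaA s : alpha s \in A s.
  by have [_ e] := hA s; apply: mem_nth; rewrite e ltn_mod.
pose v := mlead (lsub (shift_mx alpha) (newton_basis u)).
have vE s : v (up s) = (u (up s) %/ l s)%N.
  rewrite /v mlead_lsub_newton_basis; exact: (proj1 (hits_node _)).
have vu : v \in msupp (lsub (shift_mx alpha) (newton_basis u)).
  by apply: mlead_supp; apply: lsub_newton_basis_neq0.
have vw w : w \in msupp t -> w != u ->
  (lsub (shift_mx alpha) (newton_basis w))@_v = 0.
  move=> wst wu; apply/memN_msupp_eq0/negP => hv.
  have low s := lsub_newton_basis_low s hv.
  have wbad : bad w.
    apply: leq_ltn_trans ubad; apply: leq_sum => s _; rewrite -vE.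
    by apply: leq_trans (low s); apply: hits_ge.
  have wle s : (w (up s) <= u (up s))%N.
    rewrite leqNgt; apply/negP => lt; have := low s; rewrite vE leqNgt => /negP;
      apply.
    exact: (proj2 (hits_node (erefl (alpha s)))).
  have weq s : w (up s) = u (up s).
    have := umin _ wst wbad;
      rewrite /wt (bigD1 s) //= [X in (_ <= X)%N](bigD1 s) //=.
    have : (\sum_(i < n | i != s) w (up i) <= \sum_(i < n | i != s) u (up i))%N
      by apply: leq_sum.
    move=> h2 h3; apply/eqP; rewrite eqn_leq wle /=.
    by have := leq_trans (leq_add (leqnn _) h2) h3; rewrite leq_add2r.
  have hom y : lsub (shift_mx alpha) (newton_basis y) \is (mdeg y).-homog.
    by apply: lsub_homog; apply: newton_basis_homog.
  have : mdeg w = mdeg u.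
    have <- : mdeg v = mdeg w := dhomogP _ _ _ (hom w) _ hv.
    exact: (dhomogP _ _ _ (hom u) _ vu).
  rewrite !mdegE !big_ord_recl (eq_bigr (fun s => u (up s))) // => /addIn w0u0.
  case/eqP: wu; apply/mnmP => i.
  by case: (unliftP ord0 i) => [s ->|->].
have : (lsub (shift_mx alpha) (newton t))@_v =
  t@_u * (lsub (shift_mx alpha) (newton_basis u))@_v.
  rewrite /newton /lin_ext (raddf_sum (lsub _)) /= (raddf_sum (mcoeff v)) /=.
  rewrite (bigD1_seq u) ?msupp_uniq //= lsubZ mcoeffZ big1_seq ?addr0 // =>
    w /andP[wu wst].
  by rewrite lsubZ mcoeffZ vw // mulr0.
rewrite memN_msupp_eq0 => [/esym/eqP|]; last first.
  apply/negP => /(ht _ alphaA); rewrite leqNgt => /negP; apply.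
  by rewrite (eq_bigr (fun s => u (up s) %/ l s)%N).
by rewrite mulf_eq0 -[_@_v == 0]negbK -!mcoeff_msupp vu orbF -[_ == 0]negbK
  -mcoeff_msupp ut.
Qed.

(** The zero polynomial has arbitrarily large order, so [newton_key] excludes
    every monomial from its preimage. *)
Lemma newton_inj : (0 < n)%N -> injective newton.
Proof.
move=> n0 x y exy; apply/eqP; rewrite -subr_eq0 -msupp_eq0.
have z0 : newton (x - y) = 0 by rewrite raddfB /= exy subrr.
case e : (msupp (x - y)) => [//|w r].
(* One more than the order that w allows. *)
have := @newton_key (Ordinal n0)
  (\sum_(s < n | s != Ordinal n0) w (up s) %/ l s).+1 (x - y).
move=> /(_ _ w); rewrite ltnn e mem_head => h; suff: false by [].
by apply: h => // alpha _ v; rewrite z0 raddf0 msupp0.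
Qed.

End Grid.

(** * The ideal of the fat grid *)

Section InfiniteField.
Variables (K : fieldType) (hK : infinite_type K).

Lemma infinite_poly_eq0 (q : {poly K}) : (forall x, q.[x] = 0) -> q = 0.
Proof.
move=> q0; apply/eqP; apply/negP => /negP qn.
have [s us ss] : exists2 s : seq K, uniq s & size s = size q.
  elim: (size q) => [|k [s us ss]]; first by exists [::].
  by have [x xs] := hK s; exists (x :: s); rewrite /= ?xs ?us ?ss.
have := max_poly_roots qn _ us; rewrite ss ltnn => h; suff: false by [].
by apply: h; apply/allP => x _; rewrite /root q0.
Qed.

(** On the line through two coordinate points a form of degree d becomes a
    polynomial in one variable once x_0 = 1, and distinct monomials in x_0 and
    x_k of degree d remain distinct. Over an infinite field a polynomial that
    vanishes everywhere has no coefficients left. *)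
Lemma vanishing_line_weight n d (k : 'I_n) (H : {mpoly K[n.+1]}) :
  H \is d.-homog ->
  (forall c,
    H.@[(delta_mx 0 ord0 + c *: delta_mx 0 (lift ord0 k) : 'rV_n.+1) 0] = 0) ->
  forall v, v \in msupp H -> (0 < \sum_(s < n | s != k) v (lift ord0 s))%N.
Proof.
move=> hH H0 v vH; rewrite lt0n; apply/negP => /eqP v0.
(* The restriction of H to the points (1 : c) of the line. *)
pose e (j : 'I_n.+1) : {poly K} :=
  if j == ord0 then 1 else if j == lift ord0 k then 'X else 0.
pose q : {poly K} := \sum_(u <- msupp H) H@_u *: \prod_j e j ^+ u j.
have q0 : q = 0.
  apply: infinite_poly_eq0 => c; rewrite -[RHS](H0 c) mevalE horner_sum.
  apply: eq_bigr => u _; rewrite hornerZ horner_prod; congr (_ * _).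
  apply: eq_bigr => j _; rewrite horner_exp !mxE !eqxx /= /e; congr (_ ^+ _).
  case: (unliftP ord0 j) => [s ->|->]; last by rewrite hornerE mulr0 addr0.
  rewrite (inj_eq lift_inj) /= add0r.
  by case: (s == k); rewrite ?hornerX ?horner0 ?mulr1 ?mulr0.
have vz s : s != k -> v (lift ord0 s) = 0%N.
  by move=> sk; apply/eqP; move/eqP: v0; rewrite sum_nat_eq0 =>
    /forall_inP /(_ s sk).
have prodE u : (forall s, s != k -> u (lift ord0 s) = 0%N) ->
    \prod_j e j ^+ u j = 'X ^+ u (lift ord0 k).
  move=> uz; rewrite big_ord_recl {1}/e eqxx expr1n mul1r (bigD1 k) //= big1
    ?mulr1.
    by rewrite /e (inj_eq lift_inj) eqxx.
  by move=> s /uz ->; rewrite expr0.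
have : q`_(v (lift ord0 k)) = 0 by rewrite q0 coef0.
rewrite /q coef_sum (bigD1_seq v) ?msupp_uniq //= coefZ (prodE v vz) coefXn eqxx
  mulr1.
rewrite [X in _ + X]big1_seq ?addr0 => [/eqP|u /andP[uv uH]].
  by rewrite mcoeff_eq0 vH.
rewrite coefZ; apply/eqP; rewrite mulf_eq0; apply/orP; right.
have [/exists_inP[s sk us]|/exists_inPn uz] :=
    boolP [exists (s | s != k), u (lift ord0 s) != 0%N].
  rewrite (bigD1 (lift ord0 s)) //= /e (inj_eq lift_inj) (negPf sk) /=.
  by rewrite expr0n (negPf us) mul0r coef0.
have {}uz s : s != k -> u (lift ord0 s) = 0%N.
  by move=> /uz; rewrite negbK => /eqP.
rewrite (prodE u uz) coefXn.
have [euv|_ //] := eqVneq (v (lift ord0 k)) (u (lift ord0 k)); case/eqP: uv.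
have deg w : w \in msupp H -> mdeg w = d by apply: (dhomogP _ _ _ hH).
have: mdeg u = mdeg v by rewrite !deg.
rewrite !mdegE !big_ord_recl !(bigD1 (P := xpredT) k) //= !big1 // !addn0 euv =>
  /addIn u0v0.
apply/mnmP => j; case: (unliftP ord0 j) => [s ->|->] //.
by have [->|sk] := eqVneq s k; rewrite ?euv // uz ?vz.
Qed.

End InfiniteField.

Section GridIdeal.
Variables (K : fieldType) (hK : infinite_type K) (n m : nat).
Variables (l : 'I_n -> nat) (A : 'I_n -> seq K).
Hypothesis l_gt0 : forall s, (0 < l s)%N.
Hypothesis hA : grid_sets l A.
Local Notation up := (lift (ord0 : 'I_n.+1)).

Lemma row_shift_inf (alpha : 'I_n -> K) k :
  row (up k) (shift_mx alpha) = p_infty K k.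
Proof. by apply/rowP => j; rewrite !mxE /= mul0r addr0 eq_sym. Qed.

(** The coordinate p_s is one of the nodes, and the direction of the line does
    not change x_s for s <> k. *)
Lemma newton_poly_vanishes p k s : grid_basis A p -> s != k ->
  vanishing_ideal (<[p]> + <[p_infty K k]>)%VS (newton_poly l A s (l s)).
Proof.
move=> [p0 pA] sk; apply: ideal_gen_base; split.
  by exists (l s); apply: newton_poly_homog.
move=> v /memv_addP [x /vlineP [c ->] [y /vlineP [d ->] ->]].
rewrite /newton_poly rmorph_prod /=; apply/eqP; rewrite prodf_seq_eq0;
  apply/hasP.
have [_ sA] := hA s; have /(nthP 0) [i il pi] := pA s.
rewrite sA in il; exists i; first by rewrite mem_index_iota.
rewrite /line_form mevalD mevalZ !mevalXU !mxE p0 -pi /node modn_small //=.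
by rewrite (inj_eq lift_inj) (negPf sk) /= !mulr0 !addr0 mulr1 mulrC mulNr
  subrr.
Qed.

(** Multiplying by a power of x_0 changes no exponent of the other variables,
    and only these enter the order along a line of the grid; hence the
    saturation adds nothing. *)
Lemma grid_star g : fat_grid_saturated_ideal A m g <->
  exists2 t, g = newton l A t &
    forall w, w \in msupp t -> star_monomials m (mnm_quot up l w).
Proof.
split=> [[k0 hg]|[t -> ht]]; last first.
  (* The extension is contained in the intersection itself: take exponent 0. *)
  exists 0%N => x _ L [p [k [hp ->]]]; apply: ideal_genM.
  apply: (@Theta_ideal_pow _ _ _ up l _ _ (newton l A) (fun s =>
    newton_poly l A s (l s)) _ _ _ k) => //.
  - exact: lift_inj.
  - by move=> s y; apply: newton_f.
  - by move=> s sk; apply: newton_poly_vanishes hp sk.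
  - by move=> w /ht.
have [t et] := newton_surj l A g; exists t => // w wt k.
rewrite (eq_bigr (fun s => w (up s) %/ l s)%N) => [|s _]; last by rewrite mnmE.
apply: (newton_key l_gt0 hA _ wt) => alpha alphaA v.
rewrite -et => vg; pose M := shift_mx alpha; pose p := row ord0 M.
have hp : grid_basis A p.
  by split=> [|j]; rewrite !mxE ?unlift_none ?liftK ?mulr0 ?addr0 // mul1r
    add0r.
have := hg ('X_ord0 ^+ k0) _ (<[p]> + <[p_infty K k]>)%VS
  (ex_intro _ p (ex_intro _ k (conj hp erefl))).
have hX : ideal_pow (@irrelevant_ideal K n.+1) k0 ('X_ord0 ^+ k0).
  apply: ideal_gen_base; exists (fun=> 'X_ord0) => [_|].
    by apply: ideal_gen_base; exists ord0.
  by rewrite prodr_const card_ord.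
move=> /(_ hX) hpow.
have v' : (U_(ord0) *+ k0 + v)%MM \in msupp (lsub M ('X_ord0 ^+ k0 * g)).
  rewrite rmorphM rmorphXn /= lsub_X0 mpolyXn mcoeff_msupp mcoeffMXl lem_addr.
  by rewrite addmC addmK -mcoeff_msupp.
have -> : (\sum_(s < n | s != k) v (up s) =
           \sum_(s < n | s != k) (U_(ord0) *+ k0 + v)%MM (up s))%N.
  by apply: eq_bigr => s _; rewrite mnmDE mulmnE mnm1E.
apply: (@ideal_pow_weight _ _ _ (lsub M) (fun v : 'X_{1..n.+1} =>
  \sum_(s < n | s != k) v (up s))%N _ _ _ _ _ hpow _ v') => [a b|h [[d hd] h0]].
  by rewrite -big_split leq_sum // => s _ /=; rewrite mnmDE.
apply: (vanishing_line_weight hK (lsub_homog M hd)) => c.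
rewrite lsub_eval mulmxDl -scalemxAl -!rowE row_shift_inf; apply: h0.
by rewrite memv_add ?memv_line // memvZ ?memv_line.
Qed.

End GridIdeal.

Theorem proposition5p10 (K : fieldType) (hK : infinite_type K)
    (n m : nat) (hn : (2 <= n)%N) (hm : (1 <= m)%N)
    (l : 'I_n -> nat) (hl : forall j, (0 < l j)%N)
    (A : 'I_n -> seq K) (hA : grid_sets l A)
    (p : 'I_n -> 'rV[K]_n) (hp : general_points p) :
  (forall h : nat, (h <= n - 2)%N ->
     exists b : nat,
       [/\ is_total_betti (Gamma (K := K) l m) h b,
           is_total_betti (fat_grid_saturated_ideal A m) h b
         & is_total_betti (fat_points_ideal p m) h b]) /\
  ((forall j, l j = 1%N) ->
     forall (h : nat) (j : int),
       exists b : nat,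
         is_graded_betti (fat_grid_saturated_ideal A m) h j b /\
         is_graded_betti (fat_points_ideal p m) h j b).
Proof.
have [M hM] := star_resolution K n m.
have resG : minimal_graded_free_resolution (Gamma l m)
   (pushforward_complex id l (fun s => 'X_s ^+ l s) M).
  apply: (@base_change K n n id l _ _ idfun (fun s => 'X_s ^+ l s) _ _ _ _ _ _
    (fun g => Gamma_star m g hl) _ hM) => //.
  - by move=> t; exists t.
  - move=> s; rewrite mpolyXn dhomogX; apply/eqP.
    by apply: etrans (mdegMn _ _) _; rewrite mdeg1 mul1n.
have n0 : (0 < n)%N by apply: leq_trans hn.
have resY : minimal_graded_free_resolution (fat_grid_saturated_ideal A m)
   (pushforward_complex (lift ord0) l (fun s => newton_poly l A s (l s)) M).
  apply: (@base_change K n n.+1 (lift ord0) l _ _ (newton l A) (fun s =>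
    newton_poly l A s (l s)) _ _ _ _ _ _ (fun g => grid_star hK m hl hA g) _ hM)
    => //.
  - exact: lift_inj.
  - exact: newton_inj.
  - exact: newton_surj.
  - by move=> s; apply: newton_poly_homog.
  - by move=> s t; apply: newton_f.
have uP := points_unit hp; set P := points_mx p in uP.
have resP : minimal_graded_free_resolution (fat_points_ideal p m)
   (pushforward_complex id (fun=> 1%N) (fun s => lsub (invmx P) 'X_s) M).
  apply: (@base_change K n n id (fun=> 1%N) _ _ (lsub (invmx P)) (fun s =>
    lsub (invmx P) 'X_s) _ _ _ _ _ _ (points_star m hp) _ hM) => //.
  - move=> x y e; rewrite -[x]lsub1 -[y]lsub1 -(mulmxV uP) -!lsubM.
    by rewrite [lsub _ x]e.
  - by move=> t; exists (lsub P t); rewrite /= lsubM mulVmx // lsub1.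
  - by move=> s; apply: lsub_homog; rewrite dhomogX; apply/eqP; apply: mdeg1.
  - by move=> s t; rewrite rmorphM.
split=> [h _|l1 h j].
  exists (mrk M h); split; first exact: total_betti_of resG.
    exact: total_betti_of resY.
  exact: total_betti_of resP.
exists #|[set i : 'I_(mrk M h) | (mdeg (mdegs i))%:Z == j]|.
have cardE N (iota : 'I_n -> 'I_N) l' f : (forall s, l' s = 1%N) ->
    #|[set i : 'I_(rk (pushforward_complex iota l' f M) h) | shift i == j]| =
    #|[set i : 'I_(mrk M h) | (mdeg (mdegs i))%:Z == j]|.
  move=> e; apply: eq_card => i; rewrite !inE; congr (_ == j); congr Posz.
  by rewrite [LHS]mdeg_mnm_scale mdegE; apply: eq_bigr => s _; rewrite e mul1n.
split.
  by rewrite -(cardE _ (lift ord0) l (fun s => newton_poly l A s (l s)) l1);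
    exact: graded_betti_of resY.
by rewrite -(cardE _ id (fun=> 1%N) (fun s => lsub (invmx P) 'X_s)) //;
  exact: graded_betti_of resP.
Qed.
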